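(* Let $k$ be a field and $B=k\langle x,y\rangle/(y^2)$ with $\deg x=\deg y=1$. The only closed subspaces of the non-commutative scheme $\operatorname{Proj}_{nc}B$ are itself and the empty set; that is, the only closed subcategories of $\mathsf{QGr}\,B$ are $\mathsf{QGr}\,B$ and the zero subcategory.
   Context: $\mathsf{QGr}\,B:=\mathsf{Gr}\,B/\mathsf{Fdim}\,B$, where $\mathsf{Gr}\,B$ is the category of $\mathbb{Z}$-graded left $B$-modules (degree-preserving maps) and $\mathsf{Fdim}\,B$ is the Serre subcategory of modules that are unions of their finite dimensional submodules. $\operatorname{Proj}_{nc}B$ is the non-commutative scheme whose category of quasi-coherent sheaves is, by definition, $\mathsf{QGr}\,B$. A closed subspace of a non-commutative space with category of quasi-coherent sheaves $\mathsf{A}$ (a Grothendieck category) is given by a closed subcategory of $\mathsf{A}$: a full subcategory closed under subobjects, quotients, arbitrary direct sums and arbitrary products (equivalently, a full subcategory closed under subquotients whose inclusion functor has both a left and a right adjoint). The empty set corresponds to the zero subcategory. *)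

(* Defs.v *)
From HB Require Import structures.
From mathcomp Require Import all_boot all_order all_algebra.
From mathcomp Require Import boolp.
From mathcomp.multinomials Require Import monalg.

Set Implicit Arguments.
Unset Strict Implicit.
Unset Printing Implicit Defensive.

Import GRing.Theory.
Local Open Scope ring_scope.

(* Equality of morphisms is an equivalence relation on each hom set.          *)

Record category := Category {
  Ob : Type;
  Hom : Ob -> Ob -> Type;
  heq : forall X Y, Hom X Y -> Hom X Y -> Prop;
  idm : forall X, Hom X X;
  comp : forall X Y Z, Hom Y Z -> Hom X Y -> Hom X Z;
  heq_refl : forall X Y (f : Hom X Y), heq f f;
  heq_sym : forall X Y (f g : Hom X Y), heq f g -> heq g f;
  heq_trans : forall X Y (f g h : Hom X Y), heq f g -> heq g h -> heq f h;
  comp_heq : forall X Y Z (g g' : Hom Y Z) (f f' : Hom X Y),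
    heq g g' -> heq f f' -> heq (comp g f) (comp g' f');
  comp_idl : forall X Y (f : Hom X Y), heq (comp (idm Y) f) f;
  comp_idr : forall X Y (f : Hom X Y), heq (comp f (idm X)) f;
  comp_assoc : forall X Y Z T (h : Hom Z T) (g : Hom Y Z) (f : Hom X Y),
    heq (comp h (comp g f)) (comp (comp h g) f)
}.

Arguments idm {c} X.

Section CategoryNotions.
Variable C : category.

Definition monic (X Y : Ob C) (i : Hom X Y) : Prop :=
  forall W (u v : Hom W X), heq (comp i u) (comp i v) -> heq u v.

Definition epic (X Y : Ob C) (p : Hom X Y) : Prop :=
  forall W (u v : Hom Y W), heq (comp u p) (comp v p) -> heq u v.

Definition is_product (I : Type) (F : I -> Ob C) (P : Ob C)
    (p : forall i, Hom P (F i)) : Prop :=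
  forall W (q : forall i, Hom W (F i)),
    exists h : Hom W P, (forall i, heq (comp (p i) h) (q i)) /\
      forall h' : Hom W P, (forall i, heq (comp (p i) h') (q i)) -> heq h' h.

Definition is_coproduct (I : Type) (F : I -> Ob C) (S : Ob C)
    (s : forall i, Hom (F i) S) : Prop :=
  forall W (q : forall i, Hom (F i) W),
    exists h : Hom S W, (forall i, heq (comp h (s i)) (q i)) /\
      forall h' : Hom S W, (forall i, heq (comp h' (s i)) (q i)) -> heq h' h.

Definition is_zero_object (Z : Ob C) : Prop :=
  (forall X, exists f : Hom X Z, forall g : Hom X Z, heq g f) /\
  (forall X, exists f : Hom Z X, forall g : Hom Z X, heq g f).

(* A full subcategory is given by its class A of objects; closure under      *)
(* isomorphisms follows from closed_sub, and the empty coproduct gives a zero *)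
(* object.                                                                    *)
Record closed_subcategory (A : Ob C -> Prop) : Prop := ClosedSubcategory {
  closed_sub : forall X Y (i : Hom X Y), monic i -> A Y -> A X;
  closed_quo : forall X Y (p : Hom X Y), epic p -> A X -> A Y;
  closed_coprod : forall (I : Type) (F : I -> Ob C) S (s : forall i, Hom (F i) S),
    is_coproduct s -> (forall i, A (F i)) -> A S;
  closed_prod : forall (I : Type) (F : I -> Ob C) P (p : forall i, Hom P (F i)),
    is_product p -> (forall i, A (F i)) -> A P
}.

End CategoryNotions.

Section TwoSidedIdeal.
Variables (R : nzRingType) (r : R).

Definition principal_ideal : {pred R} := fun a =>
  `[< exists s : seq (R * R), a = \sum_(p <- s) p.1 * r * p.2 >].

Lemma principal_ideal_zmod_closed : zmod_closed principal_ideal.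
Proof.
split=> [|a b]; first by apply/asboolP; exists [::]; rewrite big_nil.
move=> /asboolP[s ->] /asboolP[t ->]; apply/asboolP.
exists (s ++ [seq (- p.1, p.2) | p <- t]).
rewrite big_cat big_map /= -sumrN; congr (_ + _).
by apply: eq_bigr => p _; rewrite !mulNr.
Qed.

HB.instance Definition _ :=
  GRing.isZmodClosed.Build R principal_ideal principal_ideal_zmod_closed.

Lemma principal_idealMl a b : b \in principal_ideal -> a * b \in principal_ideal.
Proof.
move=> /asboolP[s ->]; apply/asboolP; exists [seq (a * p.1, p.2) | p <- s].
by rewrite big_map mulr_sumr; apply: eq_bigr => p _; rewrite !mulrA.
Qed.

Lemma principal_idealMr a b : b \in principal_ideal -> b * a \in principal_ideal.
Proof.
move=> /asboolP[s ->]; apply/asboolP; exists [seq (p.1, p.2 * a) | p <- s].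
by rewrite big_map mulr_suml; apply: eq_bigr => p _; rewrite !mulrA.
Qed.

Lemma principal_idealM a a' b b' : a' - a \in principal_ideal ->
  b' - b \in principal_ideal -> a' * b' - a * b \in principal_ideal.
Proof.
move=> ha hb; have -> : a' * b' - a * b = (a' - a) * b' + a * (b' - b).
  by rewrite mulrBl mulrBr addrA subrK.
by apply: rpredD; [exact: principal_idealMr | exact: principal_idealMl].
Qed.

End TwoSidedIdeal.

(* The free algebra k<x,y> is the monoid algebra of the free monoid on bool, *)
(* with false and true standing for the letters x and y.                     *)

Notation word := {fmonom bool}.

Section Algebra.
Variable k : fieldType.

Notation F := {malg k[word]}.

Definition free_y : F := << fmu true >>.

Notation ideal_y2 := (principal_ideal (free_y * free_y)).

Lemma free_scalerAr (c : k) (a b : F) : c *: (a * b) = a * (c *: b).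
Proof.
have ac : c *: a = a * c%:MP.
  rewrite malgM_def fgmulgU malgZ_def; apply: eq_bigr => w _.
  by rewrite mulm1 mulrC.
by rewrite scalerAl ac -(mul_malgC c b); exact: esym (mulrA a c%:MP b).
Qed.

Lemma idealZ (c : k) b : b \in ideal_y2 -> c *: b \in ideal_y2.
Proof. by rewrite -mul_malgC; exact: principal_idealMl. Qed.

Lemma ideal1 : 1 \notin ideal_y2.
Proof.
have M (a b : F) : (a * b)@_(@mone word) = a@_(@mone word) * b@_(@mone word).
  exact: (mcoeff1g_is_multiplicative word k).1.
apply/negP => /asboolP[s] /(congr1 (mcoeff (@mone word))).
rewrite mcoeff1 eqxx raddf_sum big1 => [/eqP|p _]; first by rewrite oner_eq0.
by rewrite /= !M mcoeffU1 -fdeg_eq0 fdegU !(mul0r, mulr0).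
Qed.

Definition B : Type := @Quotient.quot F ideal_y2.

HB.instance Definition _ := Choice.on B.
HB.instance Definition _ := GRing.Zmodule.on B.

Definition piB (a : F) : B := \pi_(@Quotient.quot F ideal_y2)%qT a.

Lemma piB_eq a b : piB a = piB b <-> a - b \in ideal_y2.
Proof. by rewrite Quotient.idealrBE; split => [/eqP|/eqP]. Qed.

Lemma piBK (u : B) : piB (repr u) = u.
Proof. exact: reprK. Qed.

Lemma piB_is_zmod_morphism : zmod_morphism piB.
Proof. by move=> a b; rewrite /piB raddfB. Qed.

Definition B_one : B := piB 1.
Definition B_mul : B -> B -> B := locked (fun u v => piB (repr u * repr v)).
Definition B_scale : k -> B -> B := locked (fun c u => piB (c *: repr u)).

Lemma piB_mul a b : B_mul (piB a) (piB b) = piB (a * b).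
Proof.
by rewrite /B_mul -lock; apply/piB_eq; apply: principal_idealM; apply/piB_eq; rewrite piBK.
Qed.

Lemma piB_scale c a : B_scale c (piB a) = piB (c *: a).
Proof.
rewrite /B_scale -lock; apply/piB_eq; rewrite -scalerBr.
by apply: idealZ; apply/piB_eq; rewrite piBK.
Qed.

Lemma piBD a b : piB a + piB b = piB (a + b).
Proof. by rewrite /piB raddfD. Qed.

Lemma B_mulA : associative B_mul.
Proof. by move=> u v w; rewrite -(piBK u) -(piBK v) -(piBK w) !piB_mul mulrA. Qed.
Lemma B_mul1 : left_id B_one B_mul.
Proof. by move=> u; rewrite -(piBK u) piB_mul mul1r. Qed.
Lemma B_mulr1 : right_id B_one B_mul.
Proof. by move=> u; rewrite -(piBK u) piB_mul mulr1. Qed.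
Lemma B_mulDl : left_distributive B_mul +%R.
Proof.
by move=> u v w; rewrite -(piBK u) -(piBK v) -(piBK w) !(piB_mul, piBD) mulrDl.
Qed.
Lemma B_mulDr : right_distributive B_mul +%R.
Proof.
by move=> u v w; rewrite -(piBK u) -(piBK v) -(piBK w) !(piB_mul, piBD) mulrDr.
Qed.
Lemma B_one_neq0 : B_one != 0.
Proof.
apply/eqP; have -> : 0 = piB 0 by rewrite /piB raddf0.
by move=> /piB_eq; rewrite subr0; apply/negP/ideal1.
Qed.

HB.instance Definition _ := GRing.Zmodule_isNzRing.Build B
  B_mulA B_mul1 B_mulr1 B_mulDl B_mulDr B_one_neq0.

Lemma B_scalerA c d u : B_scale c (B_scale d u) = B_scale (c * d) u.
Proof. by rewrite -(piBK u) !piB_scale scalerA. Qed.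
Lemma B_scale1 : left_id 1 B_scale.
Proof. by move=> u; rewrite -(piBK u) piB_scale scale1r. Qed.
Lemma B_scalerDr : right_distributive B_scale +%R.
Proof.
by move=> c u v; rewrite -(piBK u) -(piBK v) !(piB_scale, piBD) scalerDr.
Qed.
Lemma B_scalerDl u : {morph B_scale^~ u : c d / c + d}.
Proof. by move=> c d /=; rewrite -(piBK u) !(piB_scale, piBD) scalerDl. Qed.

HB.instance Definition _ := GRing.Zmodule_isLmodule.Build k B
  B_scalerA B_scale1 B_scalerDr B_scalerDl.

Lemma B_scalerAl c (u v : B) : c *: (u * v) = (c *: u) * v.
Proof.
rewrite -(piBK u) -(piBK v) [LHS](congr1 (B_scale c) (piB_mul _ _)) piB_scale.
by rewrite [RHS](congr1 (B_mul^~ _) (piB_scale _ _)) piB_mul scalerAl.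
Qed.
HB.instance Definition _ := GRing.Lmodule_isLalgebra.Build k B B_scalerAl.

Lemma B_scalerAr c (u v : B) : c *: (u * v) = u * (c *: v).
Proof.
rewrite -(piBK u) -(piBK v) [LHS](congr1 (B_scale c) (piB_mul _ _)) piB_scale.
by rewrite [RHS](congr1 (B_mul _) (piB_scale _ _)) piB_mul free_scalerAr.
Qed.
HB.instance Definition _ := GRing.Lalgebra_isAlgebra.Build k B B_scalerAr.

HB.instance Definition _ := GRing.isZmodMorphism.Build F B piB piB_is_zmod_morphism.
HB.instance Definition _ := GRing.isMonoidMorphism.Build F B piB
  (erefl, fun a b => esym (piB_mul a b)).
HB.instance Definition _ := GRing.isScalable.Build k F B *:%R piB
  (fun c a => esym (piB_scale c a)).

Definition B_homog (n : int) (b : B) : Prop :=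
  exists2 a : F, b = piB a & forall w : word, a@_w != 0 -> Posz (size w) = n.

Definition bw (w : word) : B := piB << w >>.

Lemma bw_homog (w : word) : B_homog (size w) (bw w).
Proof.
exists << w >> => // v; rewrite mcoeffU1; case: (eqVneq w v) => [->//|_].
by rewrite eqxx.
Qed.

Lemma bw1 : bw (@mone word) = 1.
Proof. by []. Qed.

Lemma bwM (v w : word) : bw (mmul v w) = bw v * bw w.
Proof. by rewrite /bw -rmorphM malgM_def fgmulUU mulr1. Qed.

Lemma bw_span (b : B) :
  exists (s : seq word) (c : word -> k), b = \sum_(w <- s) c w *: bw w.
Proof.
exists (finmap.enum_fset (msupp (repr b))), (fun w => (repr b)@_w).
rewrite -[LHS]piBK [in LHS](monalgE (repr b)) raddf_sum.
apply: eq_bigr => w _; rewrite -linearZ /=; congr piB.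
by apply/malgP => v; rewrite mcoeffZ !mcoeffU mulrnAr mulr1.
Qed.

End Algebra.

(* A grading M = \bigoplus_n M_n is given by its projections pr n : M -> M_n, *)
(* so that M_n is the set of m such that pr n m = m.                          *)

Record grmod (k : fieldType) := GrMod {
  grmod_sort :> lmodType (B k);
  pr : int -> grmod_sort -> grmod_sort;
  prB : forall n u v, pr n (u - v) = pr n u - pr n v;
  pr_pr : forall m n u, pr m (pr n u) = if m == n then pr n u else 0;
  pr_sum : forall u, exists2 s : seq int, uniq s & u = \sum_(n <- s) pr n u;
  pr_act : forall i j b u, B_homog i b -> pr j u = u -> pr (i + j) (b *: u) = b *: u
}.

Section GradedModules.
Variable k : fieldType.
Implicit Types M N P : grmod k.

Record graded_submodule M (L : M -> Prop) : Prop := GradedSubmodule {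
  gsub0 : L 0;
  gsubD : forall u v, L u -> L v -> L (u + v);
  gsubZ : forall b u, L u -> L (b *: u);
  gsub_pr : forall n u, L u -> L (pr n u)
}.

Definition finite_dim_mod M (L V : M -> Prop) : Prop :=
  exists (n : nat) (e : 'I_n -> M), (forall i, V (e i)) /\
    forall v, V v -> exists c : 'I_n -> k, L (v - \sum_i (c i)%:A *: e i).

(* For graded submodules L <= U of M, the module U / L is the union of its   *)
(* finite dimensional graded submodules V / L.                               *)
Definition Fdim_subquotient M (L U : M -> Prop) : Prop :=
  forall u, U u -> exists V : M -> Prop,
    [/\ graded_submodule V, forall v, L v -> V v, forall v, V v -> U v,
        finite_dim_mod L V & V u].

Definition whole M (u : M) : Prop := True.
Definition null M (u : M) : Prop := u = 0.

(* Hom(M, N) in Gr B / Fdim B is the colimit of Hom(M', N / N') over the     *)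
(* graded submodules M' of M and N' of N such that M / M' and N' belong to   *)
(* Fdim B. A homomorphism f : M' -> N / N' in Gr B is encoded by the graded  *)
(* submodule {(u, v) | u \in M', v \in f u} of M (+) N, from which M' and N' *)
(* are recovered as its domain and as the fibre of 0.                        *)
Record qhom M N := QHom {
  graph :> M -> N -> Prop;
  graph0 : graph 0 0;
  graphD : forall u v u' v', graph u v -> graph u' v' -> graph (u + u') (v + v');
  graphZ : forall b u v, graph u v -> graph (b *: u) (b *: v);
  graph_pr : forall n u v, graph u v -> graph (pr n u) (pr n v);
  graph_dom : Fdim_subquotient (fun u => exists v, graph u v) (@whole M);
  graph_ind : Fdim_subquotient (@null N) (graph 0)
}.

(* f and g agree in the colimit: they induce the same map M0 -> N / N0.      *)
Definition qeq M N (f g : qhom M N) : Prop :=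
  exists (M0 : M -> Prop) (N0 : N -> Prop),
    [/\ graded_submodule M0 /\ graded_submodule N0,
        Fdim_subquotient M0 (@whole M) /\ Fdim_subquotient (@null N) N0,
        forall u, M0 u -> (exists v, f u v) /\ (exists v, g u v),
        forall v, f 0 v \/ g 0 v -> N0 v &
        forall u v v', M0 u -> f u v -> g u v' -> N0 (v - v')].

(* Fdim_long and long_Fdim below: U / L belongs to Fdim B if and only if each *)
(* of its elements is killed by all long enough words.                        *)
Definition long M (L : M -> Prop) (u : M) : Prop :=
  exists n : nat, forall w : word, (n <= size w)%N -> L (bw k w *: u).

Lemma pr0 M n : pr n (0 : M) = 0.
Proof. by have := prB n (0 : M) 0; rewrite subr0 subrr. Qed.

Lemma prN M n (u : M) : pr n (- u) = - pr n u.
Proof. by rewrite -[- u]sub0r prB pr0 sub0r. Qed.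

Lemma prD M n (u v : M) : pr n (u + v) = pr n u + pr n v.
Proof. by rewrite -{1}[v]opprK prB prN opprK. Qed.

Lemma pr_sumE M n (I : Type) (s : seq I) (F : I -> M) :
  pr n (\sum_(i <- s) F i) = \sum_(i <- s) pr n (F i).
Proof. exact: (big_morph (pr n) (fun u v => prD n u v) (pr0 M n)). Qed.

Lemma pr_actE M i j b (u : M) : B_homog i b -> pr (i + j) (b *: u) = b *: pr j u.
Proof.
move=> hb; have [s us ->] := pr_sum u.
rewrite scaler_sumr !pr_sumE scaler_sumr; apply: eq_bigr => n _.
have hn : pr (i + n) (b *: pr n u) = b *: pr n u.
  by apply: pr_act => //; rewrite pr_pr eqxx.
by rewrite -hn !pr_pr (inj_eq (addrI i)); case: eqP => _; rewrite ?scaler0.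
Qed.

Lemma gsubB M (L : M -> Prop) u v : graded_submodule L -> L u -> L v -> L (u - v).
Proof.
move=> hL Lu Lv; apply: (gsubD hL) => //; rewrite -scaleN1r.
exact: (gsubZ hL).
Qed.

Lemma gsub_sum M (L : M -> Prop) (I : Type) (s : seq I) (F : I -> M) :
  graded_submodule L -> (forall i, L (F i)) -> L (\sum_(i <- s) F i).
Proof.
move=> hL hF; elim/big_rec: _ => [|i x _ Lx]; first exact: gsub0 hL.
exact: (gsubD hL).
Qed.

Lemma gsub_sum_in M (L : M -> Prop) (I : eqType) (s : seq I) (F : I -> M) :
  graded_submodule L -> (forall i, i \in s -> L (F i)) -> L (\sum_(i <- s) F i).
Proof.
move=> hL hF; rewrite big_seq; elim/big_rec: _ => [|i x /hF Li Lx].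
  exact: gsub0 hL.
exact: (gsubD hL).
Qed.

Lemma gsub_null M : graded_submodule (@null M).
Proof.
split=> //; rewrite /null; first by move=> u v -> ->; rewrite addr0.
  by move=> b u ->; rewrite scaler0.
by move=> n u ->; rewrite pr0.
Qed.

Lemma gsub_whole M : graded_submodule (@whole M).
Proof. by []. Qed.

Lemma bw_act M (L : M -> Prop) u : graded_submodule L ->
  (forall w, L (bw k w *: u)) -> forall b, L (b *: u).
Proof.
move=> hL h b; have [s [c ->]] := bw_span b.
rewrite scaler_suml; apply: gsub_sum => // w.
rewrite -[bw k w]mul1r scalerAl -scalerA; exact: (gsubZ hL).
Qed.

Lemma uniform (T : eqType) (s : seq T) (Q : T -> nat -> Prop) :
  (forall t m n, (m <= n)%N -> Q t m -> Q t n) ->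
  (forall t, t \in s -> exists n, Q t n) -> exists n, forall t, t \in s -> Q t n.
Proof.
move=> hQ; elim: s => [|t s IH] h; first by exists 0%N.
have [t' ht'|n hn] := IH; first by apply: h; rewrite inE ht' orbT.
have [m hm] := h t (mem_head _ _).
exists (maxn m n) => x; rewrite inE => /predU1P[->|/hn].
  by apply: hQ hm; rewrite leq_maxl.
by apply: hQ; rewrite leq_maxr.
Qed.

Lemma words_lt n : exists s : seq word, forall w : word, (size w < n)%N -> w \in s.
Proof.
elim: n => [|n [s hs]]; first by exists [::].
exists (@mone word :: [seq mmul (fmu true) w | w <- s] ++ [seq mmul (fmu false) w | w <- s]).
move=> [[|b w]] /= hw; first by rewrite inE -val_eqE /= fm1.
have -> : FMonom (b :: w) = mmul (fmu b) (FMonom w).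
  by apply: val_inj; rewrite /= fmM fmU.
rewrite inE mem_cat; apply/orP; right; apply/orP.
by case: b ; [left | right]; apply: map_f; exact: hs.
Qed.

Lemma long_long M (L : M -> Prop) u : graded_submodule L ->
  long (long L) u -> long L u.
Proof.
move=> hL [n hn]; have [s hs] := words_lt n.+1.
have [||m hm] := @uniform word [seq w : word <- s | size w == n]
  (fun w m => forall v : word, (m <= size v)%N -> L (bw k v *: (bw k w *: u))).
- by move=> w m m' le_mm' h v /(leq_trans le_mm')/h.
- by move=> w; rewrite mem_filter => /andP[/eqP sw _]; apply: hn; rewrite sw.
exists (m + n)%N => w hw.
set i := (size w - n)%N.
have -> : w = mmul (FMonom (take i w)) (FMonom (drop i w)).
  by apply: val_inj; rewrite /= fmM /= cat_take_drop.
have sz : size (drop i w) = n.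
  by rewrite size_drop subKn // (leq_trans _ hw) // leq_addl.
rewrite bwM -scalerA; apply: hm.
  by rewrite mem_filter /= sz eqxx hs //= sz.
by rewrite /= size_takel ?leq_subr // leq_subRL 1?addnC // (leq_trans _ hw) // leq_addl.
Qed.

Lemma longW M (L : M -> Prop) u : graded_submodule L -> L u -> long L u.
Proof. by move=> hL Lu; exists 0%N => w _; apply: (gsubZ hL). Qed.

Lemma long_pr M (L : M -> Prop) n u : graded_submodule L -> long L u -> long L (pr n u).
Proof.
move=> hL [m hm]; exists m => w /hm Lw.
by rewrite -(pr_actE _ _ (bw_homog k w)); apply: (gsub_pr hL).
Qed.

Lemma Fdim_long M (L U : M -> Prop) : graded_submodule L ->
  Fdim_subquotient L U -> forall u, U u -> long L u.
Proof.
move=> hL h u /h[V [hV _ _ [n [e [Ve he]]] Vu]].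
have [D hD] : exists D : seq int, forall d i, d \notin D -> pr d (e i) = 0.
  pose Q (D : seq int) i := forall d, d \notin D -> pr d (e i) = 0.
  have : forall i, exists D, Q D i.
    move=> i; have [s _ es] := pr_sum (e i); exists s => d ds.
    rewrite es pr_sumE big_seq big1 // => j js; rewrite pr_pr.
    by case: eqP => // dj; rewrite dj js in ds.
  move=> /choice[D hD]; exists (flatten [seq D i | i : 'I_n]) => d i hd.
  apply: hD; apply: contra hd => hd; apply/flattenP; exists (D i) => //.
  exact: image_f.
have LV d v : d \notin D -> V v -> L (pr d v).
  move=> hd /he[c /(gsub_pr hL d)]; rewrite prB pr_sumE big1 ?subr0 // => i _.
  have hc : B_homog 0 ((c i)%:A : B k).
    exists ((c i)%:A); first by rewrite linearZ rmorph1.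
    move=> w; rewrite mcoeffZ mcoeff1; case: (eqVneq w (@mone word)) => [->|_]; first by rewrite fm1.
    by rewrite mulr0 eqxx.
  by rewrite -[d]add0r (pr_actE _ _ hc) hD // scaler0.
have [t _ ut] := pr_sum u.
pose m := (\max_(d <- D) `|d| + \max_(d <- t) `|d|)%N.
exists m.+1 => w hw; rewrite ut scaler_sumr; apply: gsub_sum_in => // j jt.
rewrite -(pr_actE _ _ (bw_homog k w)); apply: LV; last exact: (gsubZ hV).
apply/negP => /(@leq_bigmax_seq _ _ predT absz)/(_ isT) h1.
have /(_ isT) h2 := @leq_bigmax_seq _ _ predT absz _ jt.
have : (size w <= m)%N.
  rewrite -[size w]/(absz (Posz (size w))) -[Posz _](addrK j).
  by apply: (leq_trans (leqD_dist _ 0 _)); rewrite ?subr0 ?sub0r ?abszN leq_add.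
by rewrite leqNgt hw.
Qed.

Lemma scalar_comm M (c : k) (b : B k) (u : M) :
  b *: (c%:A *: u) = c%:A *: (b *: u).
Proof. by rewrite !scalerA mulr_algl mulr_algr. Qed.

Lemma bw_pr M (w : word) m n (u : M) :
  pr m (bw k w *: pr n u) =
    if m == Posz (size w) + n then bw k w *: pr n u else 0.
Proof.
by rewrite -(pr_actE n u (bw_homog k w)) pr_pr (pr_actE _ _ (bw_homog k w)).
Qed.

Lemma long_Fdim M (L U : M -> Prop) : graded_submodule L -> graded_submodule U ->
  (forall u, L u -> U u) -> (forall u, U u -> long L u) -> Fdim_subquotient L U.
Proof.
move=> hL hU LU h u Uu; have [n hn] := h _ Uu.
have [s hs] := words_lt n.+1; have [t _ ut] := pr_sum u.
pose E := [seq bw k (p.1 : word) *: pr p.2 u | p <- [seq (w, j) | w <- s, j <- t]].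
pose S (c : nat -> k) := \sum_(i < size E) (c i)%:A *: E`_i.
have SD c c' : S (fun i => c i + c' i) = S c + S c'.
  by rewrite /S -big_split /=; apply: eq_bigr => i _; rewrite !scalerDl.
have SZ c d : S (fun i => c * d i) = c%:A *: S d.
  rewrite /S scaler_sumr; apply: eq_bigr => i _.
  by rewrite scalerA mulr_algl scalerA.
pose V v := exists c : nat -> k, L (v - S c).
have LV v : L v -> V v.
  move=> Lv; exists (fun=> 0); rewrite /S big1 ?subr0 // => i _.
  by rewrite scale0r scale0r.
have VD v v' : V v -> V v' -> V (v + v').
  move=> [c hc] [c' hc']; exists (fun i => c i + c' i).
  by rewrite SD opprD addrACA; exact: (gsubD hL hc hc').
have VZ (c : k) v : V v -> V (c%:A *: v).
  move=> [d hd]; exists (fun i => c * d i).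
  by rewrite SZ -scalerBr; exact: (gsubZ hL).
have Vsum (I : eqType) (r : seq I) (f : I -> M) :
    (forall i, i \in r -> V (f i)) -> V (\sum_(i <- r) f i).
  move=> hf; rewrite big_seq; elim/big_rec: _ => [|i x /hf Vi Vx]; last exact: VD.
  by apply: (LV); exact: gsub0 hL.
have VE i : (i < size E)%N -> V E`_i.
  move=> hi; exists (fun j => (i == j)%:R); rewrite /S (bigD1 (Ordinal hi)) //= eqxx.
  rewrite big1 ?addr0 ?scale1r ?scale1r ?subrr => [|j]; first exact: gsub0 hL.
  by rewrite eq_sym -val_eqE /= => /negPf->; rewrite scale0r scale0r.
have Vpr (w : word) j : j \in t -> V (bw k w *: pr j u).
  move=> jt; have [wn|wn] := ltnP (size w) n; last first.
    apply: (LV); rewrite -(pr_actE _ _ (bw_homog k w)).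
    by apply: (gsub_pr hL); exact: hn.
  have hE : bw k w *: pr j u \in E.
    apply/mapP; exists (w, j) => //.
    by apply/allpairsP; exists (w, j); split => //; apply: hs; rewrite ltnW.
  by rewrite -(nth_index 0 hE); apply: (VE); rewrite index_mem.
have Ej i : (i < size E)%N ->
    exists (w : word) j, j \in t /\ E`_i = bw k w *: pr j u.
  move=> hi; have /mapP[p] := mem_nth 0 hi.
  by move=> /allpairsP[q [_ qt ->]] ->; exists q.1, q.2.
have UE i : (i < size E)%N -> U E`_i.
  move=> /Ej[w [j [_ ->]]]; apply: (gsubZ hU); exact: (gsub_pr hU).
have gV : graded_submodule V.
  split=> //.
  - by apply: (LV); exact: gsub0 hL.
  - move=> b v [c hc]; rewrite -[v](subrK (S c)).
    rewrite scalerDr; apply: (VD); first by apply: (LV); exact: (gsubZ hL).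
    rewrite scaler_sumr; apply: (Vsum) => i _.
    have [w [j [jt ->]]] := Ej i (ltn_ord i).
    have [r [d ->]] := bw_span b; rewrite scaler_suml; apply: (Vsum) => w' _.
    rewrite -[bw k w']mul1r scalerAl -scalerA; apply: (VZ).
    by rewrite scalar_comm scalerA -bwM; apply: (VZ); exact: Vpr.
  - move=> n' v [c hc]; rewrite -[v](subrK (S c)).
    rewrite prD; apply: (VD); first by apply: (LV); exact: (gsub_pr hL).
    rewrite pr_sumE; apply: (Vsum) => i _.
    have hc0 : B_homog 0 ((c i)%:A : B k).
      exists ((c i)%:A); first by rewrite linearZ rmorph1.
      move=> w; rewrite mcoeffZ mcoeff1.
      case: (eqVneq w (@mone word)) => [->|_]; first by rewrite fm1.
      by rewrite mulr0 eqxx.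
    rewrite -[n']add0r (pr_actE _ _ hc0); apply: (VZ).
    have [w [j [jt ->]]] := Ej i (ltn_ord i).
    rewrite bw_pr; case: eqP => _; first exact: Vpr.
    by apply: (LV); exact: gsub0 hL.
exists V; split=> //.
- move=> v [c hc]; rewrite -[v](subrK (S c)).
  apply: (gsubD hU); first exact: LU.
  by apply: gsub_sum => // i; apply: (gsubZ hU); exact: UE.
- exists (size E), (fun i => E`_i); split=> [i|v [c hc]]; first exact: VE.
  by exists (fun i => c i).
- rewrite ut; apply: (Vsum) => j jt; rewrite -[pr j u]scale1r -bw1; exact: Vpr.
Qed.

Lemma tors_sum M (u v : M) (L : M -> Prop) : graded_submodule L ->
  long L u -> long L v -> long L (u + v).
Proof.
move=> hL [m hm] [n hn]; exists (maxn m n) => w; rewrite geq_max => /andP[mw nw].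
by rewrite scalerDr; apply: (gsubD hL); [exact: hm | exact: hn].
Qed.

Lemma long_word M (L : M -> Prop) (w : word) u : long L u -> long L (bw k w *: u).
Proof.
move=> [n hn]; exists n => v hv; rewrite scalerA -bwM; apply: hn.
by rewrite fmM size_cat; apply: leq_trans hv _; exact: leq_addr.
Qed.

Lemma gsub_long M (L : M -> Prop) : graded_submodule L -> graded_submodule (long L).
Proof.
move=> hL; have L0 := longW hL (gsub0 hL).
have LD u v := @tors_sum M u v L hL.
split=> // [b u Lu|n u]; last exact: long_pr.
have [s [c ->]] := bw_span b; rewrite scaler_suml.
elim/big_rec: _ => [//|w x _ Lx]; apply: LD => //.
rewrite -[bw k w]mul1r scalerAl -scalerA.
have [n hn] := long_word w Lu; exists n => v /hn hv.
rewrite scalar_comm; exact: (gsubZ hL).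
Qed.

Section Graphs.
Variables (M N : grmod k) (f : qhom M N).

Definition qdom u := exists v, f u v.

Lemma gsub_dom : graded_submodule qdom.
Proof.
split.
- by exists 0; exact: graph0.
- by move=> u v [u' hu] [v' hv]; exists (u' + v'); exact: graphD.
- by move=> b u [v h]; exists (b *: v); exact: graphZ.
- by move=> n u [v h]; exists (pr n v); exact: graph_pr.
Qed.

Lemma gsub_ind : graded_submodule (f 0).
Proof.
split.
- exact: graph0.
- by move=> u v hu hv; rewrite -[0]addr0; exact: graphD.
- by move=> b u h; rewrite -(scaler0 _ b); exact: graphZ.
- by move=> n u h; rewrite -(pr0 M n); exact: graph_pr.
Qed.

Lemma dom_long u : long qdom u.
Proof. exact: (Fdim_long gsub_dom (graph_dom f)). Qed.

Lemma ind_long v : f 0 v -> long (@null N) v.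
Proof. by move=> h; apply: (Fdim_long (gsub_null N) (@graph_ind _ _ f)). Qed.

Lemma graphB u v u' v' : f u v -> f u' v' -> f (u - u') (v - v').
Proof.
move=> h h'; apply: graphD => //; rewrite -scaleN1r -[- v']scaleN1r.
exact: graphZ.
Qed.

End Graphs.

Local Notation tors := (long (@null _)).

Lemma tors_gsub M : graded_submodule (fun u : M => tors u).
Proof. exact: gsub_long (gsub_null M). Qed.

Lemma qeqP M N (f g : qhom M N) :
  qeq f g <-> forall u v v', f u v -> g u v' -> tors (v - v').
Proof.
split=> [[M0 [N0 [[hM0 hN0] [dM0 dN0] sM0 sN0 h]]] u v v' hf hg | h].
  have [n hn] := Fdim_long hM0 dM0 (u := u) I.
  apply: (long_long (gsub_null N)); exists n => w /hn hw.
  apply: (Fdim_long (gsub_null N) dN0); rewrite scalerBr.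
  by apply: (h _ _ _ hw); exact: graphZ.
pose M0 u := qdom f u /\ qdom g u.
have hM0 : graded_submodule M0.
  have hf := gsub_dom f; have hg := gsub_dom g; split.
  - by split; [exact: gsub0 hf | exact: gsub0 hg].
  - by move=> u v [? ?] [? ?]; split; [exact: (gsubD hf) | exact: (gsubD hg)].
  - by move=> b u [? ?]; split; [exact: (gsubZ hf) | exact: (gsubZ hg)].
  - by move=> n u [? ?]; split; [exact: (gsub_pr hf) | exact: (gsub_pr hg)].
exists M0, (fun v : N => tors v); split=> //.
- by split=> //; exact: tors_gsub.
- split; last first.
    apply: (long_Fdim (gsub_null N) (tors_gsub N)) => // v ->.
    exact: (gsub0 (tors_gsub N)).
  apply: (long_Fdim hM0 (gsub_whole M)) => // u _.
  have [m hm] := dom_long f u; have [n hn] := dom_long g u.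
  exists (maxn m n) => w; rewrite geq_max => /andP[mw nw].
  by split; [exact: hm | exact: hn].
- by move=> v [|]; exact: ind_long.
- by move=> u v v' _; exact: h.
Qed.

Lemma qeq_same M N (f g : qhom M N) :
  (forall u v, f u v -> g u v) -> qeq f g.
Proof.
move=> h; apply/qeqP => u v v' /h hv hv'; apply: (ind_long (f := g)).
by rewrite -(subrr u); exact: graphB.
Qed.

Lemma qeq_refl M N (f : qhom M N) : qeq f f.
Proof. exact: qeq_same. Qed.

Lemma qeq_sym M N (f g : qhom M N) : qeq f g -> qeq g f.
Proof.
move=> /qeqP h; apply/qeqP => u v v' hv hv'; rewrite -opprB -scaleN1r.
by apply: (gsubZ (tors_gsub N)); exact: h hv' hv.
Qed.

Lemma qeq_trans M N (f g h : qhom M N) : qeq f g -> qeq g h -> qeq f h.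
Proof.
move=> /qeqP fg /qeqP gh; apply/qeqP => u v v' hf hh.
have [n hn] := dom_long g u; apply: (long_long (gsub_null N)); exists n => w /hn[v1 hg].
rewrite scalerBr -(subrK v1 (bw k w *: v)) -addrA.
apply: (gsubD (tors_gsub N)).
  by apply: fg hg; exact: graphZ.
by apply: gh hg _; exact: graphZ.
Qed.

Lemma id_subproof M : Fdim_subquotient (fun u : M => exists v, u = v) (@whole M).
Proof.
apply: long_Fdim => //; last by move=> u _; exists 0%N => w _; exists (bw k w *: u).
by split; intros; eexists.
Qed.

Lemma id_ind M : Fdim_subquotient (@null M) (fun v => 0 = v).
Proof.
have e : (fun v : M => 0 = v) = @null M.
  by apply/funext => v; apply/propext; split=> /esym.
rewrite e; apply: long_Fdim => //; do ?exact: gsub_null.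
by move=> u hu; exact: (longW (gsub_null M)).
Qed.

Definition qid M : qhom M M.
Proof.
apply: (@QHom M M (fun u v => u = v)); last exact: id_ind; last exact: id_subproof.
- by [].
- by move=> u v u' v' -> ->.
- by move=> b u v ->.
- by move=> n u v ->.
Defined.

Section Composition.
Variables (M N P : grmod k) (g : qhom N P) (f : qhom M N).

Definition cgraph (u : M) (p : P) : Prop := exists2 v, f u v & g v p.

Lemma cgraph0 : cgraph 0 0.
Proof. by exists 0; exact: graph0. Qed.

Lemma cgraphD u v u' v' : cgraph u v -> cgraph u' v' -> cgraph (u + u') (v + v').
Proof.
by move=> [x fx gx] [y fy gy]; exists (x + y); exact: graphD.
Qed.

Lemma cgraphZ b u v : cgraph u v -> cgraph (b *: u) (b *: v).
Proof. by move=> [x fx gx]; exists (b *: x); exact: graphZ. Qed.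

Lemma cgraph_pr n u v : cgraph u v -> cgraph (pr n u) (pr n v).
Proof. by move=> [x fx gx]; exists (pr n x); exact: graph_pr. Qed.

Lemma cgraph_dom : Fdim_subquotient (fun u => exists p, cgraph u p) (@whole M).
Proof.
have hd : graded_submodule (fun u => exists p, cgraph u p).
  split.
  - by exists 0; exact: cgraph0.
  - by move=> u v [u' hu] [v' hv]; exists (u' + v'); exact: cgraphD.
  - by move=> b u [v h]; exists (b *: v); exact: cgraphZ.
  - by move=> n u [v h]; exists (pr n v); exact: cgraph_pr.
apply: long_Fdim => // u _; apply: (long_long hd).
have [n hn] := dom_long f u; exists n => w /hn[v hv].
have [m hm] := dom_long g v; exists m => w' /hm[p hp].
by exists p, (bw k w' *: v) => //; exact: graphZ.
Qed.

Lemma cgraph_ind : Fdim_subquotient (@null P) (cgraph 0).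
Proof.
have hd : graded_submodule (cgraph 0).
  split.
  - exact: cgraph0.
  - by move=> u v hu hv; rewrite -[0]addr0; exact: cgraphD.
  - by move=> b u h; rewrite -(scaler0 _ b); exact: cgraphZ.
  - by move=> n u h; rewrite -(pr0 M n); exact: cgraph_pr.
apply: long_Fdim => //; first exact: gsub_null.
  by move=> u ->; exact: cgraph0.
move=> p [v /ind_long[n hn] gv]; apply: (long_long (gsub_null P)); exists n => w /hn hw.
by apply: (ind_long (f := g)); rewrite -hw; exact: graphZ.
Qed.

(* For f : M' -> N / N' and g : N'' -> P / P', this is the map induced by g   *)
(* from f^-1 ((N' + N'') / N') to P / (P' + g (N' \cap N'')).                 *)
Definition qcomp : qhom M P :=
  QHom cgraph0 cgraphD cgraphZ cgraph_pr cgraph_dom cgraph_ind.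

End Composition.

Lemma qcomp_qeq M N P (g g' : qhom N P) (f f' : qhom M N) :
  qeq g g' -> qeq f f' -> qeq (qcomp g f) (qcomp g' f').
Proof.
move=> /qeqP gg /qeqP ff; apply/qeqP => u p p' [v fv gv] [v' fv' gv'].
have [n hn] := ff _ _ _ fv fv'.
apply: (long_long (gsub_null P)); exists n => w /hn/eqP.
rewrite !scalerBr subr_eq0 => /eqP e.
by apply: (gg (bw k w *: v)); [|rewrite e]; exact: graphZ.
Qed.

Lemma qcomp_idl M N (f : qhom M N) : qeq (qcomp (qid N) f) f.
Proof. by apply: qeq_same => u v [x fx <-]. Qed.

Lemma qcomp_idr M N (f : qhom M N) : qeq (qcomp f (qid M)) f.
Proof. by apply: qeq_same => u v [x -> fx]. Qed.

Lemma qcomp_assoc M N P Q (h : qhom P Q) (g : qhom N P) (f : qhom M N) :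
  qeq (qcomp h (qcomp g f)) (qcomp (qcomp h g) f).
Proof.
by apply: qeq_same => u q [p [v fv gp] hq]; exists v => //; exists p.
Qed.

End GradedModules.

Definition QGr (k : fieldType) : category :=
  @Category (grmod k) (@qhom k) (@qeq k) (@qid k)
    (fun M N P g f => qcomp g f) (@qeq_refl k) (@qeq_sym k) (@qeq_trans k)
    (@qcomp_qeq k) (@qcomp_idl k) (@qcomp_idr k) (@qcomp_assoc k).

(* Main.v *)
Require Import Defs.
From HB Require Import structures.
From mathcomp Require Import all_boot all_order all_algebra.
From mathcomp Require Import boolp functions finmap zify.
From mathcomp.multinomials Require Import monalg.

Set Implicit Arguments.
Unset Strict Implicit.
Unset Printing Implicit Defensive.

Import GRing.Theory Num.Theory.
Local Open Scope ring_scope.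

(** Call an element of a graded module torsion if it is killed by all long
enough words. In [QGr] a module is zero exactly when all its elements are
torsion ([zero_objectP]), and the zero objects form a closed subcategory for
formal reasons. Conversely, let [A] be closed and contain an [X] with an
element that is not torsion. Then every module [Y] is a subquotient of a power
of [X] ([closed_all]), hence belongs to [A]. This takes two ingredients.

The first is a description of powers. A morphism from a shift of [B] to [X] in
[QGr] is a germ: an additive map [phi : B -> X] which, modulo torsion, is
[B]-linear on the ideal spanned by the words of length at least [m], for some
[m]; two germs are the same if they differ by torsion on such an ideal. The
[I]-indexed families of germs of degree [d] form the degree [d] part of a graded
[B]-module, on which [b] acts by [(b *: phi) c = phi (c * b)], and this module is
the product of [I] copies of [X] in [QGr] ([power_product]): a morphism
[q : W -> X] and an element [u] of [W] give the germ of [c |-> q (c *: u)], which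
makes sense because [q] is defined on [c *: u] when [c] is long. The bound [m]
may depend on the index in [I], so that this power is in general larger than the
one formed with graded modules.

The second is that no nonzero element of [B] annihilates all germs
([germs_faithful]); here the shape of [B] enters. If a word [v] without [yy]
starts with [x], then [s * v] vanishes in [B] only if [s] does, hence the left
ideal [B * v] is free on [v], and it is a direct summand of the ideal of words of
length at least [size v]. So there is a germ that sends [v] to any given [a] in
[X] and kills the words that do not end in [v]. Let [b <> 0] and let [u] be a
word that occurs in [b]. Take [v = x ^ N * u] and let [a] be an element of [X]
that is not torsion; then the germ [phi] so obtained is not killed by [b], since
[phi (w * x ^ N * b)] has [w *: a] among its homogeneous components, up to a
nonzero scalar, for all words [w].

Consequently the power of [X] indexed by the pairs [(j, phi)], with [j] in a set
[J] and [phi] a germ, contains elements [e_j], with component [phi] at [(j, phi)]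
and [0] at [(j', phi)] for [j' <> j], that satisfy no nontrivial linear relation
over [B] ([diag_free]). If [J] indexes homogeneous generators of [Y], the
submodule that the [e_j] generate maps onto [Y]. *)

(** * Quotient modules and coinduced modules *)

Section QuotientModule.
Variables (R : nzRingType) (M : lmodType R) (L : zmodClosed M).
Hypothesis LZ : forall a u, u \in L -> a *: u \in L.

(** The type depends on the proof that [L] is stable under scalars, so that
unification finds this proof when it looks for the module structure. *)
Definition lquot of (forall a u, u \in L -> a *: u \in L) : Type :=
  @Quotient.quot M L.
Local Notation Q := (lquot LZ).
HB.instance Definition _ := Choice.on Q.
HB.instance Definition _ := GRing.Zmodule.on Q.

Definition lpi (u : M) : Q := \pi_(@Quotient.quot M L)%qT u.

Lemma lpi_eq u v : lpi u = lpi v <-> u - v \in L.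
Proof. by rewrite Quotient.idealrBE; split => [/eqP|/eqP]. Qed.

Lemma lpiP (x : Q) : exists u, x = lpi u.
Proof. by exists (repr x); rewrite /lpi reprK. Qed.

Lemma lpi_is_zmod_morphism : zmod_morphism lpi.
Proof. by move=> u v; rewrite /lpi raddfB. Qed.
HB.instance Definition _ := GRing.isZmodMorphism.Build M Q lpi
  lpi_is_zmod_morphism.

Definition lquot_scale (a : R) (x : Q) : Q := lpi (a *: repr x).

Lemma lquot_scaleE a u : lquot_scale a (lpi u) = lpi (a *: u).
Proof.
apply/lpi_eq; rewrite -scalerBr; apply: LZ; apply/lpi_eq.
by rewrite /lpi reprK.
Qed.

Fact lquot_scalerA a b x :
  lquot_scale a (lquot_scale b x) = lquot_scale (a * b) x.
Proof. by have [u ->] := lpiP x; rewrite !lquot_scaleE scalerA. Qed.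
Fact lquot_scale1r : left_id 1 lquot_scale.
Proof. by move=> x; have [u ->] := lpiP x; rewrite !lquot_scaleE scale1r. Qed.
Fact lquot_scalerDr : right_distributive lquot_scale +%R.
Proof.
move=> a x y; have [u ->] := lpiP x; have [v ->] := lpiP y.
by rewrite -raddfD !lquot_scaleE scalerDr raddfD.
Qed.
Fact lquot_scalerDl x : {morph lquot_scale^~ x : a b / a + b}.
Proof.
by move=> a b /=; have [u ->] := lpiP x; rewrite !lquot_scaleE scalerDl raddfD.
Qed.
HB.instance Definition _ := GRing.Zmodule_isLmodule.Build R Q
  lquot_scalerA lquot_scale1r lquot_scalerDr lquot_scalerDl.

Lemma lpiZ a u : lpi (a *: u) = a *: lpi u.
Proof. by rewrite -lquot_scaleE. Qed.

Lemma lpiD u v : lpi (u + v) = lpi u + lpi v.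
Proof. exact: raddfD. Qed.

Lemma lpiB u v : lpi (u - v) = lpi u - lpi v.
Proof. exact: raddfB. Qed.

Lemma lpi_sum (J : Type) (s : seq J) (F : J -> M) :
  lpi (\sum_(j <- s) F j) = \sum_(j <- s) lpi (F j).
Proof. exact: raddf_sum. Qed.

Lemma lpi_eq0 u : lpi u = 0 <-> u \in L.
Proof. by rewrite -(raddf0 lpi) lpi_eq subr0. Qed.

End QuotientModule.

Section CoinducedModule.
Variables (R : nzRingType) (Z : zmodType).

(** The coinduced module [Hom_Z(R, Z)]. The maps are only required to be additive
because germs are linear on long words only, and up to torsion. *)
Definition coind_pred : {pred R -> Z} := fun f => `[< zmod_morphism f >].

Fact coind_zmod_closed : zmod_closed coind_pred.
Proof.
split=> [|f g /asboolP hf /asboolP hg]; apply/asboolP => a b /=.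
  by rewrite /= subrr.
by rewrite !fctE hf hg !opprB addrACA [RHS]addrACA [- g a - _]addrC.
Qed.
HB.instance Definition _ :=
  GRing.isZmodClosed.Build (R -> Z) coind_pred coind_zmod_closed.

Record coind := Coind { coind_fun :> R -> Z; _ : coind_fun \in coind_pred }.
HB.instance Definition _ := [isSub for coind_fun].
HB.instance Definition _ := [Choice of coind by <:].
HB.instance Definition _ := [SubChoice_isSubZmodule of coind by <:].

Lemma coind_morph (f : coind) : zmod_morphism f.
Proof. by case: f => f /= /asboolP. Qed.
HB.instance Definition _ (f : coind) :=
  GRing.isZmodMorphism.Build R Z f (coind_morph f).

Definition mkcoind (f : {additive R -> Z}) : coind.
Proof. by exists f; apply/asboolP => a b; exact: raddfB. Defined.

Fact coind_scale_subproof (b : R) (f : coind) : (fun c => f (c * b)) \in coind_pred.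
Proof. by apply/asboolP => a c; rewrite mulrBl raddfB. Qed.
Definition coind_scale b f := Coind (coind_scale_subproof b f).

Lemma coindP (f g : coind) : (forall c, f c = g c) -> f = g.
Proof. by move=> h; apply/val_inj/funext. Qed.

Fact coind_scalerA a b f : coind_scale a (coind_scale b f) = coind_scale (a * b) f.
Proof. by apply: coindP => c /=; rewrite mulrA. Qed.
Fact coind_scale1r : left_id 1 coind_scale.
Proof. by move=> f; apply: coindP => c /=; rewrite mulr1. Qed.
Fact coind_scalerDr : right_distributive coind_scale +%R.
Proof. by move=> a f g; apply: coindP. Qed.
Fact coind_scalerDl f : {morph coind_scale^~ f : a b / a + b}.
Proof. by move=> a b; apply: coindP => c /=; rewrite mulrDr raddfD. Qed.
HB.instance Definition _ := GRing.Zmodule_isLmodule.Build R coind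
  coind_scalerA coind_scale1r coind_scalerDr coind_scalerDl.

End CoinducedModule.

(** * The words as a basis of the algebra *)

Section Words.
Variable k : fieldType.
Implicit Types (w : word) (b : B k).

Lemma malgE_bw (a : {malg k[word]}) : piB a = \sum_(w <- msupp a) a@_w *: bw k w.
Proof.
rewrite [in LHS](monalgE a) raddf_sum; apply: eq_bigr => w _.
rewrite -linearZ /=; congr piB.
by apply/malgP => v; rewrite mcoeffZ !mcoeffU mulrnAr mulr1.
Qed.

Lemma homog_span (i : int) b : B_homog i b ->
  exists (s : seq word) (c : word -> k),
    b = \sum_(w <- s) c w *: bw k w /\ forall w, w \in s -> Posz (size w) = i.
Proof.
move=> [a -> ha]; exists (enum_fset (msupp a)), (fun w => a@_w).
by split=> [|w hw]; [exact: malgE_bw | apply: ha; rewrite mcoeff_neq0].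
Qed.

Lemma homogZ_bw c w : B_homog (size w) (c *: bw k w).
Proof.
exists (c *: << w >>); first by rewrite linearZ.
move=> v; rewrite mcoeffZ mcoeffU1; case: (eqVneq w v) => [->//|_].
by rewrite mulr0 eqxx.
Qed.

Lemma scale_bw (M : lmodType (B k)) c w (u : M) :
  (c *: bw k w) *: u = c%:A *: (bw k w *: u).
Proof. by rewrite scalerA mulr_algl. Qed.

Definition no_yy (l l' : bool) := ~~ (l && l').

Definition legal w := sorted no_yy w.

Lemma legalPn w : ~~ legal w ->
  exists p q : word, w = mmul p (mmul (mmul (fmu true) (fmu true)) q).
Proof.
case: w => w; rewrite /legal /=; elim: w => [//|a [//|l w] IH] /=.
rewrite negb_and {1}/no_yy negbK => /orP[/andP[-> ->]|/IH [p [q e]]].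
  exists (@mone word), (FMonom w); apply: val_inj.
  by rewrite /= !fmM fm1 !fmU.
exists (mmul (fmu a) p), q; apply: val_inj.
have e' : l :: w = (mmul p (mmul (mmul (fmu true) (fmu true)) q) : word) by rewrite -e.
by rewrite /= e' !fmM fmU.
Qed.

Lemma illegal_yy (p q : word) :
  ~~ legal (mmul p (mmul (mmul (fmu true) (fmu true)) q)).
Proof.
by rewrite /legal !fmM !fmU; elim: (p : seq bool) => [//|a [|l s] IH] //=;
  rewrite ?andbF //= negb_and IH orbT.
Qed.

Lemma bw_illegal w : ~~ legal w -> bw k w = 0.
Proof.
move=> /legalPn[p [q ->]]; rewrite !bwM.
have -> : bw k (fmu true) * bw k (fmu true) = 0; last by rewrite mul0r mulr0.
rewrite -[LHS](rmorphM (@piB k)).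
have -> : 0 = @piB k 0 by rewrite raddf0.
apply/piB_eq; rewrite subr0; apply/asboolP; exists [:: (1, 1)].
by rewrite big_seq1 mul1r mulr1.
Qed.

(** A factor [yy] cannot run across a letter [x]. *)
Lemma legal_cat_x (u v : seq bool) :
  sorted no_yy (u ++ false :: v) = sorted no_yy u && sorted no_yy v.
Proof.
have px s : path no_yy false s = sorted no_yy s by case: s.
by case: u => [|a u] /=; rewrite ?px // cat_path /= /no_yy andbF /= px.
Qed.

Section LinearExtension.
Variables (M : lmodType (B k)) (f : word -> M).
Hypothesis f0 : forall w, ~~ legal w -> f w = 0.

Let extF (a : {malg k[word]}) : M := \sum_(w <- msupp a) (a@_w)%:A *: f w.

Let extFw (d : {fset word}) a : (msupp a `<=` d)%fset ->
  extF a = \sum_(w <- d) (a@_w)%:A *: f w.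
Proof.
move=> le; rewrite /extF (big_fset_incl _ le) //= => w _.
by rewrite -mcoeff_eq0 => /eqP ->; rewrite !scale0r.
Qed.

Let extF_lin c (a b : {malg k[word]}) : extF (c *: a + b) = c%:A *: extF a + extF b.
Proof.
have le : (msupp (c *: a + b) `<=` msupp a `|` msupp b)%fset.
  apply/(fsubset_trans (msuppD_le _ _))/fsetUSS => //; exact: msuppZ_le.
rewrite (extFw le) (extFw (fsubsetUl _ (msupp b))) (extFw (fsubsetUr (msupp a) _)).
rewrite scaler_sumr -big_split; apply: eq_bigr => w _ /=.
by rewrite mcoeffD mcoeffZ scalerA mulr_algl scalerA -scalerDl -scalerDl.
Qed.

Let extFU c w : extF << c *g w >> = c%:A *: f w.
Proof.
by rewrite (extFw msuppU_le) big_seq_fset1 mcoeffUU.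
Qed.

Let extF0 : extF 0 = 0.
Proof. by rewrite /extF msupp0 big_seq_fset0. Qed.

Let extF_sum (I : Type) (s : seq I) F : extF (\sum_(i <- s) F i) = \sum_(i <- s) extF (F i).
Proof.
apply: (big_morph extF) => [a b|]; last exact: extF0.
by rewrite -{1}[a]scale1r extF_lin !scale1r.
Qed.

Let malgUU (c d : k) (u v : word) :
  << c *g u >> * << d *g v >> = << c * d *g mmul u v >> :> {malg k[word]}.
Proof. by rewrite malgM_def fgmulUU. Qed.

Let extF_ideal a : a \in principal_ideal (free_y k * free_y k) -> extF a = 0.
Proof.
move=> /asboolP[s ->]; rewrite extF_sum big1 // => -[a1 a2] _ /=.
have -> : a1 * (free_y k * free_y k) * a2 = \sum_(u <- msupp a1) \sum_(v <- msupp a2)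
    << a1@_u *g u >> * (free_y k * free_y k) * << a2@_v *g v >>.
  rewrite {1}[a1]monalgE {1}[a2]monalgE.
  rewrite (mulr_suml _ _ _ (free_y k * free_y k)) mulr_suml.
  by apply: eq_bigr => u _; rewrite mulr_sumr.
rewrite extF_sum big1 // => u _; rewrite extF_sum big1 // => v _.
rewrite /free_y; set Y := fmu true.
rewrite (malgUU 1 1 Y Y) (malgUU _ (1 * 1) u (mmul Y Y)) (malgUU _ _ (mmul u (mmul Y Y))).
by rewrite extFU -(mulmA u) f0 ?scaler0 // illegal_yy.
Qed.

(** The ideal generated by [y * y] is spanned by words that are not legal, so a
map that vanishes on them extends. In other words, the legal words are linearly
independent in [B]. *)
Lemma word_ext : exists g : {additive B k -> M},
  (forall w, g (bw k w) = f w) /\ (forall c b, g (c *: b) = c%:A *: g b).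
Proof.
pose g (b : B k) := extF (repr b).
have gpi a : g (piB a) = extF a.
  apply/eqP; rewrite /g -subr_eq0 -scaleN1r addrC; apply/eqP.
  have -> : (-1 : B k) = (- 1 : k)%:A by rewrite scaleN1r.
  rewrite -extF_lin extF_ideal // scaleN1r addrC.
  by apply/piB_eq; rewrite piBK.
have gB : zmod_morphism g.
  move=> u v; rewrite -(piBK u) -(piBK v) -raddfB !gpi.
  rewrite addrC -scaleN1r extF_lin scaleN1r addrC; congr (_ + _).
  by rewrite !scaleN1r.
pose gmix := GRing.isZmodMorphism.Build _ _ g gB.
exists (HB.pack g gmix : {additive B k -> M}); split => /= [w|c b].
  by rewrite gpi extFU !scale1r.
by rewrite -(piBK b) -linearZ !gpi -[c *: repr b]addr0 extF_lin extF0 addr0.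
Qed.

End LinearExtension.
End Words.

(** * The graded module spanned by independent homogeneous parts *)

(** The parts need not span [M], and no projections onto them are given: those
of [gspan_mod] come from the uniqueness of components that [deg_indep] ensures.
*)
Record grading (k : fieldType) (M : lmodType (B k)) := Grading {
  deg :> int -> M -> Prop;
  deg0 : forall n, deg n 0;
  degB : forall n u v, deg n u -> deg n v -> deg n (u - v);
  deg_act : forall i j b u, B_homog i b -> deg j u -> deg (i + j) (b *: u);
  deg_indep : forall (s : seq int) (f : int -> M), uniq s ->
    (forall d, deg d (f d)) -> \sum_(d <- s) f d = 0 -> forall d, d \in s -> f d = 0
}.

Section GradedSpan.
Variables (k : fieldType) (M : lmodType (B k)) (D : grading M).
Implicit Types (u v : M) (f : int -> M).

Definition components u f := (forall d, D d (f d)) /\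
  exists s, [/\ uniq s, forall d, d \notin s -> f d = 0 & u = \sum_(d <- s) f d].

(** Decompositions come with their own supports; this lets two of them be
compared on the union. *)
Lemma sum_supp (s t : seq int) f : uniq s -> uniq t -> {subset s <= t} ->
  (forall d, d \notin s -> f d = 0) -> \sum_(d <- t) f d = \sum_(d <- s) f d.
Proof.
move=> us ut st f0; rewrite (bigID (mem s)) /= [X in _ + X]big1 ?addr0 => [|d]; last exact: f0.
rewrite -big_filter; apply: perm_big; apply: uniq_perm => //; first exact: filter_uniq.
by move=> d; rewrite mem_filter andb_idr //; exact: st.
Qed.

Lemma componentsB u v f g : components u f -> components v g ->
  components (u - v) (fun d => f d - g d).
Proof.
move=> [Df [s [us fs ->]]] [Dg [t [ut gt ->]]]; split=> [d|]; first exact: degB.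
exists (undup (s ++ t)); split=> [|d|]; first exact: undup_uniq.
  by rewrite mem_undup mem_cat negb_or => /andP[/fs-> /gt->]; rewrite subrr.
rewrite sumrB; congr (_ - _); apply/esym/sum_supp; rewrite ?undup_uniq // => d hd;
  by rewrite mem_undup mem_cat hd ?orbT.
Qed.

Lemma components1 n u : D n u -> components u (fun d => if d == n then u else 0).
Proof.
move=> Du; split=> [d|]; first by case: eqP => [->//|_]; exact: deg0.
exists [:: n]; split=> // [d|]; first by rewrite inE => /negPf ->.
by rewrite big_seq1 eqxx.
Qed.

Lemma components0 : components 0 (fun=> 0).
Proof. by split=> [d|]; [exact: deg0 | exists [::]; rewrite big_nil]. Qed.

Lemma components_uniq u f g : components u f -> components u g -> f =1 g.
Proof.
move=> cf cg; have [Dh [s [us hs]]] := componentsB cf cg.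
rewrite subrr => /esym /(deg_indep us Dh) h0 d; apply/eqP; rewrite -subr_eq0; apply/eqP.
by have [/h0//|/hs] := boolP (d \in s).
Qed.

Definition span_pred : {pred M} := fun u => `[< exists f, components u f >].

Fact span_zmod_closed : zmod_closed span_pred.
Proof.
split=> [|u v /asboolP[f hf] /asboolP[g hg]]; apply/asboolP.
  by eexists; exact: components0.
by eexists; exact: componentsB hf hg.
Qed.
HB.instance Definition _ := GRing.isZmodClosed.Build M span_pred span_zmod_closed.

Lemma deg_span n u : D n u -> u \in span_pred.
Proof. by move=> Du; apply/asboolP; eexists; exact: components1 Du. Qed.

Fact span_scaler_closed : GRing.scaler_closed span_pred.
Proof.
move=> b u /asboolP[f [Df [s [_ _ ->]]]]; rewrite scaler_sumr; apply: rpred_sum => d _.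
have [t [c ->]] := bw_span b; rewrite scaler_suml; apply: rpred_sum => w _.
exact: (deg_span (deg_act (homogZ_bw _ _) (Df d))).
Qed.
HB.instance Definition _ := GRing.isScaleClosed.Build (B k) M span_pred
  span_scaler_closed.

Record gspan := GSpan { gspan_val :> M; _ : gspan_val \in span_pred }.
HB.instance Definition _ := [isSub for gspan_val].
HB.instance Definition _ := [Choice of gspan by <:].
HB.instance Definition _ := [SubChoice_isSubLmodule of gspan by <:].

Lemma gspan_ex (u : gspan) : exists f, components (\val u) f.
Proof. by case: u => u /= /asboolP. Qed.

Definition gcomp (u : gspan) : int -> M := projT1 (cid (gspan_ex u)).

Lemma gcompP (u : gspan) : components (\val u) (gcomp u).
Proof. by rewrite /gcomp; case: cid. Qed.

Lemma gcompE (u : gspan) f : components (\val u) f -> gcomp u =1 f.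
Proof. exact: components_uniq (gcompP u). Qed.

Lemma gcomp_deg (u : gspan) n : D n (gcomp u n).
Proof. by have [] := gcompP u. Qed.

Definition gpr n (u : gspan) : gspan := GSpan (deg_span (gcomp_deg u n)).

Fact gprB n (u v : gspan) : gpr n (u - v) = gpr n u - gpr n v.
Proof.
apply: val_inj; rewrite raddfB /=; apply: (gcompE (f := fun d => _ - _)).
by rewrite raddfB; exact: componentsB (gcompP u) (gcompP v).
Qed.

Lemma gpr_deg n (u : gspan) m : D m (\val u) -> gpr n u = if n == m then u else 0.
Proof.
move=> Du; apply: val_inj; rewrite /= (gcompE (components1 Du)).
by case: eqP.
Qed.

Fact gpr_pr m n (u : gspan) : gpr m (gpr n u) = if m == n then gpr n u else 0.
Proof. by apply: gpr_deg; exact: gcomp_deg. Qed.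

Fact gpr_sum (u : gspan) : exists2 s : seq int, uniq s & u = \sum_(n <- s) gpr n u.
Proof.
have [_ [s [us _ es]]] := gcompP u; exists s => //.
by apply: val_inj; rewrite raddf_sum.
Qed.

Fact gpr_act i j b (u : gspan) : B_homog i b -> gpr j u = u -> gpr (i + j) (b *: u) = b *: u.
Proof.
move=> hb hu; rewrite (@gpr_deg _ _ (i + j)) ?eqxx // linearZ.
by apply: deg_act => //; rewrite -hu; exact: gcomp_deg.
Qed.

Definition gspan_mod : grmod k := GrMod gprB gpr_pr gpr_sum gpr_act.

End GradedSpan.

(** * Torsion, and elements that are homogeneous up to torsion *)

Lemma subrBB (V : zmodType) (x y z t : V) : (x - y) - (z - t) = (x - z) - (y - t).
Proof. by rewrite !opprB addrACA [RHS]addrACA [- y - _]addrC. Qed.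

Local Notation tors := (long (@null _ _)).

Section Torsion.
Variables (k : fieldType) (M : grmod k).
Implicit Types u v : M.

Lemma tors0 : tors (0 : M). Proof. exact: gsub0 (tors_gsub M). Qed.
Lemma torsD u v : tors u -> tors v -> tors (u + v).
Proof. exact: gsubD (tors_gsub M) u v. Qed.
Lemma torsB u v : tors u -> tors v -> tors (u - v).
Proof. exact: gsubB (tors_gsub M). Qed.
Lemma torsZ b u : tors u -> tors (b *: u).
Proof. exact: gsubZ (tors_gsub M) b u. Qed.
Lemma tors_pr n u : tors u -> tors (pr n u).
Proof. exact: gsub_pr (tors_gsub M) n u. Qed.
Lemma torsBC u v : tors (u - v) -> tors (v - u).
Proof. by move=> h; rewrite -opprB -scaleN1r; exact: torsZ. Qed.
Lemma torsB_trans v u w : tors (u - v) -> tors (v - w) -> tors (u - w).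
Proof. by move=> h h'; have := torsD h h'; rewrite addrA subrK. Qed.
Lemma torsBl u v : tors (u - v) -> tors v -> tors u.
Proof. by move=> h h'; rewrite -(subrK v u); exact: torsD. Qed.
Lemma pr_scalar n (c : k) u : pr n (c%:A *: u) = c%:A *: pr n u.
Proof.
have hc : B_homog 0 (c%:A : B k) by have := homogZ_bw c (@mone word); rewrite fm1 bw1.
by rewrite -{1}[n]add0r (pr_actE _ _ hc).
Qed.

(** Torsion is invisible in [QGr], so degrees of values of germs only make sense
modulo torsion. *)
Definition near_deg n u := tors (u - pr n u).

Lemma near_deg0 n : near_deg n 0.
Proof. by rewrite /near_deg pr0 subr0; exact: tors0. Qed.
Lemma near_degD n u v : near_deg n u -> near_deg n v -> near_deg n (u + v).
Proof. by rewrite /near_deg prD opprD addrACA; exact: torsD. Qed.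
Lemma near_degB n u v : near_deg n u -> near_deg n v -> near_deg n (u - v).
Proof. by rewrite /near_deg prB subrBB; exact: torsB. Qed.
Lemma near_deg_trans n u v : tors (u - v) -> near_deg n v -> near_deg n u.
Proof.
move=> h hv; apply: (torsB_trans h); apply: (torsB_trans hv).
by rewrite -prB; apply: tors_pr; exact: torsBC.
Qed.
Lemma near_degZ n (c : k) u : near_deg n u -> near_deg n (c%:A *: u).
Proof.
by rewrite /near_deg pr_scalar -scalerBr; exact: torsZ.
Qed.

Lemma near_deg_pr n u : near_deg n u -> forall m, m != n -> tors (pr m u).
Proof.
by move=> h m /negPf mn; have := tors_pr m h; rewrite prB pr_pr mn subr0.
Qed.
Lemma tors_bigsum (I : eqType) (s : seq I) (P : pred I) (F : I -> M) :
  (forall i, i \in s -> P i -> tors (F i)) -> tors (\sum_(i <- s | P i) F i).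
Proof.
move=> h; rewrite big_seq_cond; elim/big_rec: _ => [|i x /andP[si Pi]].
  exact: tors0.
by apply: torsD; exact: h.
Qed.

Lemma tors_long u : (exists n, forall w : word, (n <= size w)%N -> tors (bw k w *: u)) ->
  tors u.
Proof. by move=> h; exact: (long_long (gsub_null M)). Qed.
End Torsion.

Section QHomBuilder.
Variables (k : fieldType) (M N : grmod k) (G : M -> N -> Prop).
Hypotheses (G0 : G 0 0)
  (GD : forall u v u' v', G u v -> G u' v' -> G (u + u') (v + v'))
  (GZ : forall b u v, G u v -> G (b *: u) (b *: v))
  (Gpr : forall n u v, G u v -> G (pr n u) (pr n v))
  (Gdom : forall u, long (fun u => exists v, G u v) u)
  (Gind : forall v, G 0 v -> tors v).

(** By [long_Fdim], the conditions on [Fdim] in [qhom] can be checked on long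
words. *)
Definition mkqhom : qhom M N.
Proof.
apply: (@QHom k M N G) => //; apply: long_Fdim => //.
- split; first by exists 0.
  + by move=> u v [u' hu] [v' hv]; exists (u' + v'); exact: GD.
  + by move=> b u [v h]; exists (b *: v); exact: GZ.
  + by move=> n u [v h]; exists (pr n v); exact: Gpr.
- exact: gsub_null.
- split=> //.
  + by move=> u v hu hv; rewrite -[0]addr0; exact: GD.
  + by move=> b u h; rewrite -(scaler0 _ b); exact: GZ.
  + by move=> n u h; rewrite -(pr0 M n); exact: Gpr.
- by move=> u ->.
Defined.

End QHomBuilder.

(** * Germs at long words *)

Section Deep.
Variable k : fieldType.
Implicit Types (b c : B k) (w : word).

(** The left ideal generated by the words of length at least [m]. It is also a
right ideal, which is why right multiplication acts on germs. *)
Definition deep m c := exists s : seq (B k * word),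
  (forall t, t \in s -> (m <= size t.2)%N) /\ c = \sum_(t <- s) t.1 * bw k t.2.

Lemma deepD m c c' : deep m c -> deep m c' -> deep m (c + c').
Proof.
move=> [s [hs ->]] [t [ht ->]]; exists (s ++ t); split; last by rewrite big_cat.
by move=> p; rewrite mem_cat => /orP[/hs|/ht].
Qed.

Lemma deep0 m : deep m 0.
Proof. by exists [::]; rewrite big_nil. Qed.

Lemma deepM m b w : (m <= size w)%N -> deep m (b * bw k w).
Proof. by exists [:: (b, w)]; rewrite big_seq1; split=> // t; rewrite inE => /eqP->. Qed.

Lemma deep_bw m w : (m <= size w)%N -> deep m (bw k w).
Proof. by rewrite -[bw k w]mul1r; exact: deepM. Qed.

Lemma deep_sum m (I : eqType) (s : seq I) (F : I -> B k) :
  (forall i, i \in s -> deep m (F i)) -> deep m (\sum_(i <- s) F i).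
Proof.
move=> h; rewrite big_seq; elim/big_rec: _ => [|i c /h]; first exact: deep0.
exact: deepD.
Qed.

Lemma deepMl m b c : deep m c -> deep m (b * c).
Proof.
move=> [s [hs ->]]; rewrite mulr_sumr; apply: deep_sum => t ts.
by rewrite mulrA; apply: deepM; exact: hs.
Qed.

Lemma deepMr m b c : deep m c -> deep m (c * b).
Proof.
move=> [s [hs ->]]; have [r [a ->]] := bw_span b.
rewrite mulr_suml; apply: deep_sum => t ts; rewrite mulr_sumr; apply: deep_sum => v _.
rewrite -scalerAr -mulrA -bwM scalerAl; apply: deepM.
by rewrite fmM size_cat (leq_trans (hs _ ts)) ?leq_addr.
Qed.

Lemma deepS m n c : (m <= n)%N -> deep n c -> deep m c.
Proof.
by move=> le [s [hs ->]]; exists s; split=> // t /hs; exact: leq_trans.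
Qed.

End Deep.

Section Germs.
Variables (k : fieldType) (X : grmod k).
Implicit Types (b c : B k) (w : word) (phi psi : B k -> X).

Definition eventually (P : B k -> Prop) := exists m, forall c, deep m c -> P c.

Definition germ_null phi := eventually (fun c => tors (phi c)).

Definition germ_lin phi :=
  eventually (fun c => forall b, tors (phi (b * c) - b *: phi c)).

Definition germ_deg (d : int) phi := exists m, forall w, (m <= size w)%N ->
  near_deg (Posz (size w) + d) (phi (bw k w)).

(** [phi] is the germ of the composite of [q] with the map [c |-> c *: u] from
[B] to [W]. With [q] the identity, this says that [phi] is the germ of
multiplication by [u] itself. *)
Definition tracks (W : grmod k) (q : qhom W X) (u : W) phi :=
  eventually (fun c => exists2 x, q (c *: u) x & tors (phi c - x)).

Lemma eventually_and (P Q : B k -> Prop) :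
  eventually P -> eventually Q -> eventually (fun c => P c /\ Q c).
Proof.
move=> [m hm] [n hn]; exists (maxn m n) => c hc.
by split; [apply: hm|apply: hn]; apply: deepS hc; rewrite ?leq_maxl ?leq_maxr.
Qed.

Lemma eventually_mono (P Q : B k -> Prop) : (forall c, P c -> Q c) ->
  eventually P -> eventually Q.
Proof. by move=> h [m hm]; exists m => c /hm /h. Qed.

Lemma eventuallyM (P : B k -> Prop) b :
  eventually P -> eventually (fun c => P (c * b)).
Proof. by move=> [m hm]; exists m => c /(deepMr b) /hm. Qed.

Lemma germ_lin_null phi : germ_null phi -> germ_lin phi.
Proof.
by move=> [m hm]; exists m => c hc b; apply: torsB; [apply/hm/deepMl | apply/torsZ/hm].
Qed.

Lemma germ_nullB phi psi : germ_null phi -> germ_null psi ->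
  germ_null (fun c => phi c - psi c).
Proof.
move=> h h'; apply: eventually_mono (eventually_and h h') => c [].
exact: torsB.
Qed.

Lemma germ_linB phi psi : germ_lin phi -> germ_lin psi ->
  germ_lin (fun c => phi c - psi c).
Proof.
move=> h h'; apply: eventually_mono (eventually_and h h') => c [l l'] b.
by rewrite scalerBr subrBB; exact: torsB.
Qed.

Lemma germ_linD phi psi : germ_lin phi -> germ_lin psi ->
  germ_lin (fun c => phi c + psi c).
Proof.
move=> h h'; apply: eventually_mono (eventually_and h h') => c [l l'] b.
by rewrite scalerDr opprD addrACA; exact: torsD.
Qed.

Lemma germ_degB d phi psi : germ_deg d phi -> germ_deg d psi ->
  germ_deg d (fun c => phi c - psi c).
Proof.
move=> [m hm] [n hn]; exists (maxn m n) => w; rewrite geq_max => /andP[mw nw].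
by apply: near_degB; [exact: hm | exact: hn].
Qed.

Lemma germ_linM phi b : germ_lin phi -> germ_lin (fun c => phi (c * b)).
Proof. by move=> /(eventuallyM b); apply: eventually_mono => c h b'; rewrite -mulrA. Qed.

Lemma germ_degM i j phi b : (forall c c', phi (c + c') = phi c + phi c') ->
  B_homog i b -> germ_lin phi -> germ_deg j phi ->
  germ_deg (i + j) (fun c => phi (c * b)).
Proof.
move=> phiD /homog_span[s [a [-> hs]]] [m hm] [n hn]; exists (maxn m n) => w.
rewrite geq_max => /andP[mw nw].
have phi0 : phi 0 = 0 by apply: (addrI (phi 0)); rewrite -phiD !addr0.
rewrite mulr_sumr (big_morph phi phiD phi0) big_seq.
elim/big_rec: _ => [|v x vs hx]; first exact: near_deg0.
apply: near_degD hx; rewrite -scalerAr -bwM; set u := mmul w v.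
have su : size u = (size w + size v)%N by rewrite /u fmM size_cat.
have mu : (m <= size u)%N by rewrite su (leq_trans mw) ?leq_addr.
have nu : (n <= size u)%N by rewrite su (leq_trans nw) ?leq_addr.
have hl : tors (phi (a v *: bw k u) - (a v)%:A *: phi (bw k u)).
  by have := hm _ (deep_bw k mu) (a v)%:A; rewrite mulr_algl.
apply: near_deg_trans hl _; apply: near_degZ.
by have := hn _ nu; rewrite su PoszD (hs _ vs) addrA.
Qed.

(** A family of pairwise distinct degrees can be separated in the sum: in degree
[size w + n] of the value at [w], every summand other than [psi n] is torsion. *)
Lemma germ_deg_comp (s : seq int) n phi (psi : int -> B k -> X) :
  uniq s -> n \in s -> (forall d, germ_deg d (psi d)) ->
  germ_null (fun c => phi c - \sum_(d <- s) psi d c) ->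
  exists m, forall w, (m <= size w)%N ->
    tors (psi n (bw k w) - pr (Posz (size w) + n) (phi (bw k w))).
Proof.
move=> us ns hpsi [m hm].
have [||m' hm'] := @uniform int s (fun d n => forall w : word, (n <= size w)%N ->
    near_deg (Posz (size w) + d) (psi d (bw k w))).
- by move=> d n1 n2 le h w hw; apply: h; exact: leq_trans hw.
- by move=> d _; exact: hpsi.
exists (maxn m m') => w; rewrite geq_max => /andP[mw m'w].
have := tors_pr (Posz (size w) + n) (hm _ (deep_bw k mw)).
rewrite prB pr_sumE => /torsBC; apply: torsB_trans.
apply: (torsB_trans (hm' _ ns _ m'w)).
rewrite (bigD1_seq n) //= opprD addNKr -sub0r; apply: torsB; first exact: tors0.
apply: tors_bigsum => d ds dn; apply: (near_deg_pr (hm' _ ds _ m'w)).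
by rewrite (inj_eq (addrI _)) eq_sym.
Qed.

End Germs.

(** Scalars and words generate [B], and the elements [b * w] with [w] long span
the ideal of deep elements. *)
Lemma germ_lin_word (k : fieldType) (X : grmod k) (phi : {additive B k -> X}) :
  (forall c b, phi (c *: b) = c%:A *: phi b) ->
  (exists m, forall v w : word, (m <= size w)%N ->
     tors (phi (bw k (mmul v w)) - bw k v *: phi (bw k w))) ->
  germ_lin phi.
Proof.
move=> phiZ [m hm]; exists m => c [s [hs ->]] b.
rewrite mulr_sumr !(raddf_sum phi) scaler_sumr -sumrB.
apply: tors_bigsum => t /hs mt _.
have key b' : tors (phi (b' * bw k t.2) - b' *: phi (bw k t.2)).
  have [r [a ->]] := bw_span b'.
  rewrite mulr_suml (raddf_sum phi) scaler_suml -sumrB.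
  apply: gsub_sum => [|v]; first exact: tors_gsub.
  rewrite -scalerAl -bwM scale_bw phiZ -scalerBr; apply: torsZ; exact: hm.
rewrite mulrA; apply: (torsB_trans (key _)).
by rewrite -scalerA -scalerBr; apply/torsZ/torsBC/key.
Qed.

Section Tracks.
Variables (k : fieldType) (X W : grmod k) (q : qhom W X).
Implicit Types (b c : B k) (w : word) (phi psi : B k -> X) (u : W).

Lemma qhom_tors u x : q u x -> tors u -> tors x.
Proof.
move=> qu [n hn]; apply: tors_long; exists n => w /hn hw.
by apply: (ind_long (f := q)); rewrite -hw; exact: graphZ.
Qed.

Lemma qhom_fun u x y : q u x -> q u y -> tors (x - y).
Proof.
by move=> qx qy; apply: (ind_long (f := q)); rewrite -(subrr u); exact: graphB.
Qed.

Lemma tracksB u v phi psi : tracks q u phi -> tracks q v psi ->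
  tracks q (u - v) (fun c => phi c - psi c).
Proof.
move=> h h'; apply: eventually_mono (eventually_and h h') => c [[x qx hx] [y qy hy]].
by exists (x - y); [rewrite scalerBr; exact: graphB | rewrite subrBB; exact: torsB].
Qed.

Lemma tracks0 : tracks q 0 (fun=> 0).
Proof.
by exists 0%N => c _; exists 0; rewrite ?scaler0 ?subr0; [exact: graph0|exact: tors0].
Qed.

Lemma tracksD u v phi psi : tracks q u phi -> tracks q v psi ->
  tracks q (u + v) (fun c => phi c + psi c).
Proof.
move=> h h'; have := tracksB h (tracksB tracks0 h'); rewrite sub0r opprK.
by apply: eventually_mono => c [x qx hx]; exists x => //; rewrite sub0r opprK in hx.
Qed.

Lemma tracksZ b u phi : tracks q u phi -> tracks q (b *: u) (fun c => phi (c * b)).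
Proof.
move=> /(eventuallyM b); apply: eventually_mono => c [x qx hx].
by exists x; rewrite ?scalerA.
Qed.

Lemma tracks_near u phi psi : germ_null (fun c => phi c - psi c) ->
  tracks q u psi -> tracks q u phi.
Proof.
move=> h h'; apply: eventually_mono (eventually_and h h') => c [hc [x qx hx]].
by exists x => //; exact: torsB_trans hc hx.
Qed.

Lemma tracks_lin u phi : tracks q u phi -> germ_lin phi.
Proof.
move=> [m hm]; exists m => c hc b.
have [x qx hx] := hm _ hc; have [y qy hy] := hm _ (deepMl b hc).
apply: (torsB_trans hy); apply: (@torsB_trans _ _ (b *: x)); last first.
  by rewrite -scalerBr; apply/torsZ/torsBC.
by apply: (qhom_fun qy); rewrite -scalerA; exact: graphZ.
Qed.

Section Words.
Variables (u : W) (phi : B k -> X).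
Hypotheses (phiD : forall c c', phi (c + c') = phi c + phi c') (philin : germ_lin phi).

(** Once [phi] is eventually linear, its values at long words determine its germ.
*)
Lemma tracks_word : (exists m, forall w, (m <= size w)%N ->
    exists2 x, q (bw k w *: u) x & tors (phi (bw k w) - x)) -> tracks q u phi.
Proof.
have [m hm] := philin; move=> [n hn]; exists (maxn m n) => c [s [hs ->]].
have phi0 : phi 0 = 0 by apply: (addrI (phi 0)); rewrite -phiD !addr0.
rewrite (big_morph phi phiD phi0) scaler_suml big_seq [\sum_(t <- s) phi _]big_seq.
elim/big_rec2: _ => [|t z z' ts [y qy hy]].
  by exists 0; rewrite ?subr0; [exact: graph0 | exact: tors0].
have := hs _ ts; rewrite geq_max => /andP[mt nt].
have [x qx hx] := hn _ nt; exists (t.1 *: x + y).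
  by rewrite -scalerA; apply: graphD => //; exact: graphZ.
rewrite opprD addrACA; apply: torsD hy.
apply: (torsB_trans (hm _ (deep_bw k mt) t.1)).
by rewrite -scalerBr; exact: torsZ.
Qed.

End Words.

(** A projection acts on the germ of [c |-> q (c *: u)] by projecting the value at
a word [w] to degree [size w + n]. *)
Lemma tracks_pr n u phi psi : (forall c c', phi (c + c') = phi c + phi c') ->
  germ_lin phi -> tracks q u psi ->
  (exists m, forall w, (m <= size w)%N ->
    tors (phi (bw k w) - pr (Posz (size w) + n) (psi (bw k w)))) ->
  tracks q (pr n u) phi.
Proof.
move=> phiD lphi [m hm] [m' hm']; apply: tracks_word => //.
exists (maxn m m') => w; rewrite geq_max => /andP[mw m'w].
have [x qx hx] := hm _ (deep_bw k mw).
exists (pr (Posz (size w) + n) x).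
  by rewrite -(pr_actE _ _ (bw_homog k w)); exact: graph_pr.
by apply: (torsB_trans (hm' _ m'w)); rewrite -prB; exact: tors_pr.
Qed.

Lemma tracks_deg n u phi : pr n u = u -> tracks q u phi -> germ_deg n phi.
Proof.
move=> hu [m hm]; exists m => w mw; have [x qx hx] := hm _ (deep_bw k mw).
apply: (near_deg_trans hx); apply: (qhom_fun qx).
by rewrite -{1}hu -(pr_actE _ _ (bw_homog k w)); exact: graph_pr.
Qed.

(** Choose a value of [q] at [w *: u] for each long legal word [w] and extend by
[word_ext]. Two values of [q] differ by torsion, so the choices do not affect
linearity modulo torsion. *)
Lemma tracks_ex u : exists phi : {additive B k -> X}, tracks q u phi.
Proof.
have [m hm] := dom_long q u.
have /choice[f hf] : forall w, exists x, q (bw k w *: u) x \/ (x = 0 /\ ~ qdom q (bw k w *: u)).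
  move=> w; have [[x qx]|nq] := pselect (qdom q (bw k w *: u)); first by exists x; left.
  by exists 0; right.
pose g w := if legal w then f w else 0.
have [|phi [phiE phiZ]] := @word_ext k X g; first by move=> w /negPf; rewrite /g => ->.
have hphi w : (m <= size w)%N -> q (bw k w *: u) (phi (bw k w)).
  move=> mw; rewrite phiE /g; case: ifP => [_|/negbT/(bw_illegal k)->].
    by have [//|[_ []]] := hf w; exact: hm.
  by rewrite scale0r; exact: graph0.
exists phi; apply: tracks_word; [exact: raddfD| |]; last first.
  by exists m => w mw; exists (phi (bw k w)); [exact: hphi | rewrite subrr; exact: tors0].
apply: germ_lin_word => //; exists m => v w mw.
apply: (@qhom_fun (bw k (mmul v w) *: u)).
  by apply: hphi; rewrite fmM size_cat (leq_trans mw) ?leq_addl.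
by rewrite bwM -scalerA; apply: graphZ; exact: hphi.
Qed.

End Tracks.

(** The germs of [c |-> c *: x] and [c |-> q (c *: u)] determine [x] and [q u] up to
torsion. *)
Lemma tracks_val (k : fieldType) (X W : grmod k) (q : qhom W X) u x y phi :
  tracks (qid X) x phi -> tracks q u phi -> q u y -> tors (x - y).
Proof.
move=> h h' qy; have [m hm] := eventually_and h h'; apply: tors_long.
exists m => w mw; have [[x' /= <- hx'] [y' qy' hy']] := hm _ (deep_bw k mw).
rewrite scalerBr; apply: (torsB_trans (torsBC hx')); apply: (torsB_trans hy').
by apply: (qhom_fun qy'); exact: graphZ.
Qed.

(** A long word [w] times a germ [phi] is the germ of multiplication by
[phi w]. This makes a germ with values in [X] an element of [X], up to modules
that vanish in [QGr]. *)
Lemma tracks_id_ex (k : fieldType) (X : grmod k) (phi : {additive B k -> X}) :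
  germ_lin phi -> exists m, forall w : word, (m <= size w)%N ->
    tracks (qid X) (phi (bw k w)) (fun c => phi (c * bw k w)).
Proof.
move=> [m hm]; exists m => w mw; exists 0%N => c _; exists (c *: phi (bw k w)) => //.
exact: hm (deep_bw k mw) c.
Qed.

Lemma tracks_null (k : fieldType) (X W : grmod k) (q : qhom W X) (u : W) phi :
  tors u -> tracks q u phi -> germ_null phi.
Proof.
move=> hu; apply: eventually_mono => c [x qx hx].
by apply: (torsBl hx); apply: (qhom_tors qx); exact: torsZ.
Qed.

Lemma null_tracks (k : fieldType) (X W : grmod k) (q : qhom W X) phi :
  germ_null phi -> tracks q 0 phi.
Proof.
apply: eventually_mono => c hc; exists 0; last by rewrite subr0.
by rewrite scaler0; exact: graph0.
Qed.

Lemma tracks_id_null (k : fieldType) (X : grmod k) (x : X) phi :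
  germ_null phi -> tracks (qid X) x phi -> tors x.
Proof.
move=> h h'; rewrite -[x]subr0; apply: (tracks_val h' (null_tracks (qid X) h)) => /=.
exact: erefl.
Qed.

Lemma germ_null_word (k : fieldType) (X : grmod k) (phi : {additive B k -> X}) :
  germ_lin phi ->
  (exists m, forall w : word, (m <= size w)%N -> tors (phi (bw k w))) -> germ_null phi.
Proof.
move=> lphi [m hm]; apply: (@tracks_null _ _ _ (qid X) 0); first exact: tors0.
apply: tracks_word => //; first exact: raddfD.
exists m => w /hm hw; exists 0; last by rewrite subr0.
by rewrite scaler0; exact: graph0.
Qed.

(** * Powers of an object of the quotient category *)

Section Power.
Variables (k : fieldType) (X : grmod k) (I : Type).
Notation E := (coind (B k) (I -> X)).
Implicit Types (f g : E) (i : I).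

Definition entry i f : B k -> X := fun c => f c i.

Lemma entry_zmod i f : zmod_morphism (entry i f).
Proof. by move=> a b; rewrite /entry raddfB. Qed.
HB.instance Definition _ i f :=
  GRing.isZmodMorphism.Build (B k) X (entry i f) (entry_zmod i f).

Lemma entry_sum i (J : Type) (s : seq J) (F : J -> E) c :
  entry i (\sum_(j <- s) F j) c = \sum_(j <- s) entry i (F j) c.
Proof. by elim/big_rec2: _ => [|j x f _ <-]. Qed.

(** The bound beyond which an entry is torsion may depend on the index, so these
families need not be torsion: they have to be divided out. *)
Definition null_pred : {pred E} := fun f => `[< forall i, germ_null (entry i f) >].

Fact null_zmod_closed : zmod_closed null_pred.
Proof.
split=> [|f g /asboolP hf /asboolP hg]; apply/asboolP => i.
  by exists 0%N => c _; exact: tors0.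
exact: (germ_nullB (hf i) (hg i)).
Qed.
HB.instance Definition _ := GRing.isZmodClosed.Build E null_pred null_zmod_closed.

Fact nullZ b f : f \in null_pred -> b *: f \in null_pred.
Proof. by move=> /asboolP hf; apply/asboolP => i; exact: (eventuallyM b (hf i)). Qed.

Notation Q := (lquot nullZ).
Notation cls := (lpi nullZ).

Lemma clsP f g : cls f = cls g -> forall i, germ_null (fun c => entry i f c - entry i g c).
Proof. by move=> /lpi_eq /asboolP. Qed.

Definition power_deg (d : int) (x : Q) := exists2 f, x = cls f &
  forall i, germ_lin (entry i f) /\ germ_deg d (entry i f).

Fact power_deg0 n : power_deg n 0.
Proof.
exists 0; first by rewrite raddf0.
move=> i; split; last by exists 0%N => w _; exact: near_deg0.
by apply: germ_lin_null; exists 0%N => c _; exact: tors0.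
Qed.

Fact power_degB n x y : power_deg n x -> power_deg n y -> power_deg n (x - y).
Proof.
move=> [f -> hf] [g -> hg]; exists (f - g); first by rewrite raddfB.
move=> i; have [[lf df] [lg dg]] := (hf i, hg i).
by split; [exact: (germ_linB lf lg) | exact: (germ_degB df dg)].
Qed.

Fact power_deg_act d j b x : B_homog d b -> power_deg j x -> power_deg (d + j) (b *: x).
Proof.
move=> hb [f -> hf]; exists (b *: f); first by rewrite lpiZ.
move=> i; have [lf df] := hf i; split; first exact: (germ_linM b lf).
exact: (germ_degM (raddfD (entry i f)) hb lf df).
Qed.

(** Apply [germ_deg_comp] to the zero germ, entry by entry. *)
Fact power_deg_indep (s : seq int) (x : int -> Q) : uniq s ->
  (forall d, power_deg d (x d)) -> \sum_(d <- s) x d = 0 ->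
  forall d, d \in s -> x d = 0.
Proof.
move=> us hx hs d0 ds.
have /choice[f hf] : forall d, exists f, x d = cls f /\
    forall i, germ_lin (entry i f) /\ germ_deg d (entry i f).
  by move=> d; have [f ? ?] := hx d; exists f.
rewrite (hf d0).1; apply/lpi_eq0/asboolP => i; apply: germ_null_word.
  exact: ((hf d0).2 i).1.
have : cls 0 = cls (\sum_(d <- s) f d).
  by rewrite raddf0 lpi_sum -[LHS]hs; apply: eq_bigr => d _; exact: (hf d).1.
move=> /clsP/(_ i) e.
have [|m hm] := germ_deg_comp us ds (fun d => ((hf d).2 i).2) (phi := fun=> 0).
  apply: eventually_mono e => c; congr tors; congr (_ - _); exact: entry_sum.
by exists m => w /hm; rewrite pr0 subr0.
Qed.

Definition power_grading := Grading power_deg0 power_degB power_deg_act power_deg_indep.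

Definition power : grmod k := gspan_mod power_grading.

Implicit Types x : power.

Definition represents x f := cls f = \val x.

Lemma representsD x y f g : represents x f -> represents y g -> represents (x + y) (f + g).
Proof. by rewrite /represents => hf hg; rewrite lpiD hf hg. Qed.

Lemma representsB x y f g : represents x f -> represents y g -> represents (x - y) (f - g).
Proof. by rewrite /represents => hf hg; rewrite lpiB hf hg. Qed.

Lemma representsZ b x f : represents x f -> represents (b *: x) (b *: f).
Proof. by rewrite /represents => hf; rewrite lpiZ hf. Qed.

Lemma represents0 : represents 0 0.
Proof. exact: raddf0. Qed.

Lemma represents_null x f : represents x f -> (forall i, germ_null (entry i f)) -> x = 0.
Proof. by move=> hx hf; apply: val_inj; rewrite -hx; apply/lpi_eq0/asboolP. Qed.

Lemma represents_near x f g i : represents x f -> represents x g ->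
  germ_null (fun c => entry i f c - entry i g c).
Proof. by move=> hf hg; apply: clsP; rewrite hf hg. Qed.

(** Projections of [power] are defined through unique components; on
representatives they amount to projecting values at long words. *)
Lemma represents_pr n x f : represents x f -> exists2 g, represents (pr n x) g &
  forall i, germ_lin (entry i g) /\
    exists m, forall w : word, (m <= size w)%N ->
      tors (entry i g (bw k w) - pr (Posz (size w) + n) (entry i f (bw k w))).
Proof.
move=> hf; have [Dx [s [us xs es]]] := gcompP x.
have /choice[g hg] : forall d, exists g, gcomp x d = cls g /\
    forall i, germ_lin (entry i g) /\ germ_deg d (entry i g).
  by move=> d; have [g ? ?] := Dx d; exists g.
exists (g n) => [|i]; first by rewrite /represents -(hg n).1.
split; first exact: ((hg n).2 i).1.
pose t := if n \in s then s else n :: s.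
have [ut nt et] : [/\ uniq t, n \in t & \val x = \sum_(d <- t) gcomp x d].
  rewrite /t; case: ifP => [//|ns]; rewrite /= ns us mem_head big_cons.
  by rewrite xs ?ns // add0r.
apply: (germ_deg_comp ut nt (fun d => ((hg d).2 i).2)).
have : cls f = cls (\sum_(d <- t) g d).
  by rewrite hf et lpi_sum; apply: eq_bigr => d _; exact: (hg d).1.
by move=> /clsP/(_ i); apply: eventually_mono => c; congr tors; congr (_ - _); exact: entry_sum.
Qed.

Lemma represents_ex x : exists2 f, represents x f & forall i, germ_lin (entry i f).
Proof.
have [s _ ->] := pr_sum x; elim/big_rec: _ => [|d y _ [f hf lf]].
  exists 0; first exact: represents0.
  by move=> i; apply: germ_lin_null; exists 0%N => c _; exact: tors0.
have [g hg] := lpiP (\val x).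
have [h hh lh] := represents_pr d (esym hg).
exists (h + f) => [|i]; first exact: representsD.
exact: (germ_linD (lh i).1 (lf i)).
Qed.

End Power.

Section PowerProduct.
Variables (k : fieldType) (X : grmod k) (I : Type).
Notation E := (coind (B k) (I -> X)).
Notation P := (power X I).
Implicit Types (f g : E) (i : I) (x : P).

(** An entry is sent to the [y], unique up to torsion, such that it is the germ
of multiplication by [y]. *)
Definition proj_graph i x (y : X) :=
  exists2 f, represents x f & tracks (qid X) y (entry i f).

Fact proj0 i : proj_graph i 0 0.
Proof. by exists 0; [exact: represents0 | exact: tracks0]. Qed.

Fact projD i x y x' y' : proj_graph i x y -> proj_graph i x' y' ->
  proj_graph i (x + x') (y + y').
Proof.
by move=> [f hf tf] [g hg tg]; exists (f + g); [exact: representsD | exact: tracksD].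
Qed.

Fact projZ i b x y : proj_graph i x y -> proj_graph i (b *: x) (b *: y).
Proof.
by move=> [f hf tf]; exists (b *: f); [exact: representsZ | exact: (tracksZ b tf)].
Qed.

Fact proj_pr i n x y : proj_graph i x y -> proj_graph i (pr n x) (pr n y).
Proof.
move=> [f hf tf]; have [g hg lg] := represents_pr n hf; exists g => //.
by apply: (tracks_pr (raddfD (entry i g)) (lg i).1 tf (lg i).2).
Qed.

Fact proj_dom i x : long (fun x => exists y, proj_graph i x y) x.
Proof.
have [f hf lf] := represents_ex x; have [m hm] := tracks_id_ex (lf i).
exists m => w /hm hw; exists (entry i f (bw k w)), (bw k w *: f) => //.
exact: representsZ.
Qed.

Fact proj_ind i y : proj_graph i 0 y -> tors y.
Proof.
move=> [f hf tf]; apply: tracks_id_null tf.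
have := represents_near i hf (represents0 X I).
by apply: eventually_mono => c; rewrite subr0.
Qed.

Definition proj i : qhom P X :=
  mkqhom (proj0 i) (@projD i) (@projZ i) (@proj_pr i) (proj_dom i) (@proj_ind i).

Section Factor.
Variables (W : grmod k) (q : I -> qhom W X).

(** The morphism induced by [q] sends [u] to the family of the germs of
[c |-> q i (c *: u)]. *)
Definition factor_graph (u : W) x :=
  exists2 f, represents x f & forall i, tracks (q i) u (entry i f).

Fact factor0 : factor_graph 0 0.
Proof. by exists 0 => [|i]; [exact: represents0 | exact: tracks0]. Qed.

Fact factorD u x v y : factor_graph u x -> factor_graph v y ->
  factor_graph (u + v) (x + y).
Proof.
by move=> [f hf tf] [g hg tg]; exists (f + g) => [|i];
  [exact: representsD | exact: (tracksD (tf i) (tg i))].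
Qed.

Fact factorZ b u x : factor_graph u x -> factor_graph (b *: u) (b *: x).
Proof.
by move=> [f hf tf]; exists (b *: f) => [|i];
  [exact: representsZ | exact: (tracksZ b (tf i))].
Qed.

Fact factor_pr n u x : factor_graph u x -> factor_graph (pr n u) (pr n x).
Proof.
move=> [f hf tf]; have [g hg lg] := represents_pr n hf; exists g => // i.
by apply: (tracks_pr (raddfD (entry i g)) (lg i).1 (tf i) (lg i).2).
Qed.

Lemma factor_total u : exists x, factor_graph u x.
Proof.
have [s _ ->] := pr_sum u; elim/big_rec: _ => [|n v _ [y hy]].
  by exists 0; exact: factor0.
have [x hx] : exists x, factor_graph (pr n u) x; last by exists (x + y); exact: factorD.
have /choice[phi hphi] i := tracks_ex (q i) (pr n u).
have phiB : zmod_morphism (fun c i => phi i c).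
  by move=> a b; apply/funext => i; exact: raddfB.
pose f := mkcoind (HB.pack (fun c i => phi i c)
  (GRing.isZmodMorphism.Build (B k) (I -> X) _ phiB) : {additive B k -> (I -> X)}).
have Df : power_deg n (lpi (@nullZ k X I) f).
  exists f => // i; split; first exact: (tracks_lin (hphi i)).
  by apply: (tracks_deg _ (hphi i)); rewrite pr_pr eqxx.
by exists (GSpan (deg_span (D := power_grading X I) Df)), f.
Qed.

Fact factor_dom u : long (fun u => exists x, factor_graph u x) u.
Proof. by exists 0%N => w _; exact: factor_total. Qed.

Lemma factor_ind x : factor_graph 0 x -> x = 0.
Proof.
move=> [f hf tf]; apply: (represents_null hf) => i.
by apply: tracks_null (tf i); exact: tors0.
Qed.

Definition factor : qhom W P.
Proof.
apply: (mkqhom factor0 factorD factorZ factor_pr factor_dom) => x /factor_ind ->.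
exact: tors0.
Defined.

Lemma proj_factor i : qeq (qcomp (proj i) factor) (q i).
Proof.
apply/qeqP => u y y' [x [f hf tf] [g hg tg]] hy'.
apply: tracks_val (tf i) hy'; apply: tracks_near tg.
exact: (represents_near i hf hg).
Qed.

End Factor.

(** Uniqueness: if [h] composed with the projections gives [q] and [h] sends [u] to
the class of [g], then it sends [w *: u] to [w *: g] for each long word [w], and
the [i]-th projection of that is [g w i]; so [g w i] is a value of [q i] at
[w *: u], up to torsion. *)
Theorem power_product : @is_product (QGr k) I (fun=> X) P proj.
Proof.
move=> W q; exists (factor q); split=> [i|h hh]; first exact: proj_factor.
apply/qeqP => u x x' hx [f hf tf].
suff -> : x - x' = 0 by exact: tors0.
have [g hg lg] := represents_ex x.
apply: (represents_null (representsB hg hf)) => i.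
apply: germ_null_word; first exact: (germ_linB (lg i) (tracks_lin (tf i))).
have [m hm] := tf i; have [m' hm'] := tracks_id_ex (lg i).
exists (maxn m m') => w; rewrite geq_max => /andP[mw m'w].
have [z qz hz] := hm _ (deep_bw k mw); apply: torsB_trans (torsBC hz).
apply: (proj1 (qeqP _ _) (hh i)) qz; exists (bw k w *: x); first exact: graphZ.
by exists (bw k w *: g); [exact: representsZ | exact: hm'].
Qed.

End PowerProduct.

(** * Germs separate the elements of the algebra *)

Section Strip.
Variables (k : fieldType) (X : grmod k).
Implicit Types (v w : word) (a : X).

(** The map with [s * v |-> s *: a] which kills the words that do not end in [v].
If [w] is shorter than [v], the truncated difference is [0] and the test fails
for lack of length. *)
Definition strip v a w : X :=
  if drop (size w - size v) w == v :> seq bool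
  then bw k (FMonom (take (size w - size v) w)) *: a else 0.

Lemma strip_mul v a w w' : (size v <= size w')%N ->
  strip v a (mmul w w') = bw k w *: strip v a w'.
Proof.
move=> le; rewrite /strip fmM size_cat -addnBA // drop_cat take_cat.
rewrite ltnNge leq_addr /= addKn; case: ifP => _; last by rewrite scaler0.
rewrite scalerA -bwM; congr (bw k _ *: a); apply: val_inj.
by rewrite /= fmM.
Qed.

(** Since [v] starts with [x], the word [s * v] is legal as soon as [s] is, so
that [strip] vanishes on the words that are zero in [B]. *)
Lemma strip_ext v a d : legal v -> head true v = false ->
  pr (Posz (size v) + d) a = a -> exists phi : {additive B k -> X},
  [/\ germ_lin phi, germ_deg d phi, (forall c b, phi (c *: b) = c%:A *: phi b)
     & forall w, phi (bw k w) = strip v a w].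
Proof.
move=> lv hv ha.
have [s ev] : exists s, v = false :: s :> seq bool.
  by case: v hv {lv ha} => -[//|[//|] s] _; exists s.
have [w ilw|phi [phiE phiZ]] := @word_ext k X (strip v a).
  rewrite /strip; case: eqP => // ew.
  rewrite (_ : bw k _ = 0) ?scale0r //; apply: bw_illegal; apply: contra ilw => lw.
  rewrite /legal -(cat_take_drop (size w - size v) w) ew {2}ev legal_cat_x.
  by apply/andP; split; [exact: lw | move: lv; rewrite /legal ev; exact: path_sorted].
exists phi; split=> //.
  apply: germ_lin_word => //; exists (size v) => u w le.
  by rewrite !phiE strip_mul // subrr; exact: tors0.
exists 0%N => w _; rewrite phiE /strip; case: eqP => [ew|_]; last exact: near_deg0.
suff h : Posz (size w) + d = Posz (size (take (size w - size v) w)) + (Posz (size v) + d).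
  rewrite /near_deg h (pr_actE _ _ (bw_homog k (FMonom _))) ha subrr.
  exact: tors0.
rewrite addrA -PoszD; congr (Posz _ + d).
by rewrite -[in LHS](cat_take_drop (size w - size v) w) size_cat ew.
Qed.

End Strip.

Section Faithful.
Variables (k : fieldType) (X : grmod k).
Hypothesis X_ntors : exists x : X, ~ tors x.

(** If all words of length [n] sent an element into torsion, that element would be
torsion. So a homogeneous element that is not torsion has multiples of this kind
in every larger degree. *)
Lemma ntors_deg : exists e : int, forall n : nat, exists2 a : X,
  pr (Posz n + e) a = a & ~ tors a.
Proof.
have [x hx] := X_ntors; have [s _ es] := pr_sum x.
have [e he] : exists e, ~ tors (pr e x).
  apply: contrapT => h; apply: hx; rewrite es; apply: tors_bigsum => d _ _.
  by apply: contrapT => hd; apply: h; exists d.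
exists e => n; apply: contrapT => h; apply: he; apply: tors_long; exists n => w nw.
have -> : w = mmul (FMonom (take (size w - n) w)) (FMonom (drop (size w - n) w)).
  by apply: val_inj; rewrite /= fmM /= cat_take_drop.
rewrite bwM -scalerA; apply: torsZ; apply: contrapT => hw; apply: h.
exists (bw k (FMonom (drop (size w - n) w)) *: pr e x) => //.
rewrite -[n in Posz n](_ : size (FMonom (drop (size w - n) w)) = n).
  by rewrite (pr_actE _ _ (bw_homog k _)) pr_pr eqxx.
by rewrite /= size_drop subKn.
Qed.

(** Among the legal words that occur in [b] take any [u], and strip
[v = x ^ N * u]. The exponent [N] is positive so that [v] starts with [x], and
large enough for [X] to have an element [a] of degree [size v + d] that is not
torsion. *)
Lemma germs_faithful (d : int) (b : B k) : b != 0 -> exists phi : {additive B k -> X},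
  [/\ germ_lin phi, germ_deg d phi & ~ germ_null (fun c => phi (c * b))].
Proof.
move=> b0; set r := repr b.
have [u ur lu] : exists2 u, u \in msupp r & legal u.
  apply: contrapT => h; move/eqP: b0; apply.
  rewrite -(piBK b) malgE_bw big_seq big1 // => u ur.
  by rewrite bw_illegal ?scaler0 //; apply/negP => lu; apply: h; exists u.
have [e he] := ntors_deg.
pose N := (absz (e - d - Posz (size u))%R).+1.
pose xN : word := FMonom (nseq N false).
pose v := mmul xN u.
have sv : size v = (N + size u)%N by rewrite /v fmM size_cat size_nseq.
have lv : legal v.
  rewrite /legal /v fmM /= /N; elim: (absz _) => [|n IH] /=.
    by have := legal_cat_x [::] u; rewrite /= => ->.
  exact: IH.
have [n hn] : exists n, Posz n + e = Posz (size v) + d.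
  by exists (absz (Posz (size v) + d - e)%R); rewrite sv /N; lia.
have [a ha na] := he n; rewrite hn in ha.
have [|phi [lphi dphi phiZ phiE]] := strip_ext lv _ ha; first by rewrite /v fmM.
exists phi; split=> // -[m hm]; apply: na; apply: tors_long; exists m => w mw.
have := tors_pr (Posz (size w) + (Posz (size v) + d)) (hm _ (deepMr (bw k xN) (deep_bw k mw))).
rewrite -bwM -(piBK b) malgE_bw mulr_sumr (raddf_sum phi) pr_sumE.
(* In degree [size w + size v + d] only the word [u] contributes: a word [t]
   with [w * x ^ N * t = s * v] contributes in degree [size s + size v + d], and
   [size s = size w] forces [t = u]. *)
have term t : t \in msupp r -> pr (Posz (size w) + (Posz (size v) + d))
    (phi (bw k (mmul w xN) * (r@_t *: bw k t))) =
    if t == u then (r@_t)%:A *: (bw k w *: a) else 0.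
  move=> tr; rewrite -scalerAr -bwM phiZ phiE pr_scalar -mulmA.
  case: eqP => [->|tu].
    rewrite strip_mul // /strip subnn drop0 eqxx take0 -ha.
    rewrite (_ : FMonom [::] = @mone word) ?bw1 ?scale1r ?bw_pr ?eqxx //.
    by apply: val_inj; rewrite /= fm1.
  rewrite /strip; case: eqP => [ew|_]; last by rewrite pr0 scaler0.
  rewrite -ha bw_pr; case: eqP => [es|_]; last by rewrite scaler0.
  case: tu; apply: val_inj; move: ew es; set z := mmul _ _ => ew es.
  have sz : size (take (size z - size v) z) = size w by move: es => /addIr [].
  have := cat_take_drop (size z - size v) z; rewrite ew /z /v !fmM catA => /eqP.
  rewrite [X in _ == X]catA eqseq_cat ?size_cat; last first.
    by move: sz; rewrite /z /v !fmM !size_cat => ->.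
  by move=> /andP[_ /eqP].
rewrite (eq_big_seq _ term) (bigD1_seq u) //= ?fset_uniq // eqxx => h.
have {h} : tors ((r@_u)%:A *: (bw k w *: a)).
  by move: h; rewrite big1 ?addr0 // => t /negPf ->.
move: (bw k w *: a) => y /(torsZ (r@_u)^-1%:A).
by rewrite scalerA mulr_algl scalerA mulVf ?mcoeff_neq0 // !scale1r.
Qed.
End Faithful.

(** * A linearly independent family in a power *)

Section FreeFamily.
Variables (k : fieldType) (X : grmod k) (J : eqType) (d : J -> int).
Hypothesis X_ntors : exists x : X, ~ tors x.

Notation I := (J * (B k -> X))%type.

Definition germ_hom j (phi : B k -> X) :=
  [/\ zmod_morphism phi, germ_lin phi & germ_deg (d j) phi].

(** The index set is made of all functions [B k -> X] rather than of the germs of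
degree [d j], which would be a dependent type; the entries at other functions
are set to [0]. *)
Definition diag_fun j (c : B k) (i : I) : X :=
  if (j == i.1) && `[< germ_hom i.1 i.2 >] then i.2 c else 0.

Fact diag_additive j : zmod_morphism (diag_fun j).
Proof.
move=> a b; apply/funext => i; rewrite /diag_fun !fctE.
case: ifP => [/andP[_ /asboolP[hi _ _]]|_]; first exact: hi.
by rewrite subrr.
Qed.

Definition diag j : coind (B k) (I -> X) :=
  mkcoind (HB.pack (diag_fun j)
    (GRing.isZmodMorphism.Build (B k) (I -> X) _ (diag_additive j)) : {additive B k -> (I -> X)}).

Lemma diag_deg j : power_deg (d j) (lpi (@nullZ k X I) (diag j)).
Proof.
exists (diag j) => // i; rewrite /entry /= /diag_fun.
have [/andP[/eqP ji /asboolP[_ li di]]|_] := boolP (_ && _); first by rewrite ji.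
split; last by exists 0%N => w _; exact: near_deg0.
by apply: germ_lin_null; exists 0%N => c _; exact: tors0.
Qed.

Definition diag_elt j : power X I := GSpan (deg_span (D := power_grading X I) (diag_deg j)).

Lemma diag_elt_pr j : pr (d j) (diag_elt j) = diag_elt j.
Proof.
rewrite [LHS](@gpr_deg _ _ (power_grading X I) (d j) (diag_elt j) (d j)) ?eqxx //.
exact: diag_deg.
Qed.

(** The entry at [(j, phi)] of a relation says that the coefficient of the [j]-th
element kills [phi]; apply [germs_faithful]. *)
Lemma diag_free (s : seq (B k * J)) : \sum_(t <- s) t.1 *: diag_elt t.2 = 0 ->
  forall j, \sum_(t <- s | t.2 == j) t.1 = 0.
Proof.
move=> hs j; apply/eqP; apply: contrapT => /negP b0.
have [phi [lphi dphi nphi]] := germs_faithful X_ntors (d j) b0; apply: nphi.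
have rs : represents (\sum_(t <- s) t.1 *: diag_elt t.2) (\sum_(t <- s) t.1 *: diag t.2).
  elim/big_rec2: _ => [|t f x _ hx]; first exact: represents0.
  by apply: representsD => //; exact: representsZ.
rewrite hs in rs.
apply: eventually_mono (represents_near (j, phi : B k -> X) rs (represents0 X I)) => c.
rewrite subr0 entry_sum mulr_sumr raddf_sum /=.
congr tors; rewrite [RHS]big_mkcond; apply: eq_bigr => t _; rewrite /diag_fun /=.
by rewrite asboolT ?andbT //; split=> //; exact: raddfB.
Qed.

End FreeFamily.

(** * Submodules, monomorphisms and epimorphisms *)

Section Submodule.
Variables (k : fieldType) (M : grmod k) (L : M -> Prop).
Hypothesis hL : graded_submodule L.

Definition sub_deg n (u : M) := pr n u = u /\ L u.

Fact sub_deg0 n : sub_deg n 0.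
Proof. by split; [exact: pr0 | exact: gsub0 hL]. Qed.
Fact sub_degB n u v : sub_deg n u -> sub_deg n v -> sub_deg n (u - v).
Proof. by move=> [hu Lu] [hv Lv]; split; [rewrite prB hu hv | exact: gsubB]. Qed.
Fact sub_deg_act i j b u : B_homog i b -> sub_deg j u -> sub_deg (i + j) (b *: u).
Proof. by move=> hb [hu Lu]; split; [exact: pr_act | exact: gsubZ hL _ _ Lu]. Qed.
Fact sub_deg_indep (s : seq int) (f : int -> M) : uniq s ->
  (forall d, sub_deg d (f d)) -> \sum_(d <- s) f d = 0 -> forall d, d \in s -> f d = 0.
Proof.
move=> us hf hs d ds; have := congr1 (pr d) hs.
rewrite pr0 pr_sumE (bigD1_seq d) //= big1 => [|n /negPf dn]; last first.
  by rewrite -(hf n).1 pr_pr eq_sym dn.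
by rewrite addr0 (hf d).1.
Qed.

Definition sub_grading := Grading sub_deg0 sub_degB sub_deg_act sub_deg_indep.
Definition submod : grmod k := gspan_mod sub_grading.

Lemma submod_pr n (u : submod) : \val (pr n u) = pr n (\val u).
Proof.
have [Df [s [us fs es]]] := gcompP u; rewrite [LHS]/= es pr_sumE.
have [ns|ns] := boolP (n \in s); last first.
  rewrite fs // big1_seq // => d /andP[_ ds]; rewrite -(Df d).1 pr_pr.
  by case: eqP ds ns => // -> ->.
rewrite (bigD1_seq n) //= big1 => [|m /negPf mn]; last first.
  by rewrite -(Df m).1 pr_pr eq_sym mn.
by rewrite addr0 (Df n).1.
Qed.

Lemma submodP (u : submod) : L (\val u).
Proof.
have [Df [s [_ _ ->]]] := gcompP u; apply: gsub_sum => // d; exact: (Df d).2.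
Qed.

Lemma submod_ex (u : M) : L u -> exists v : submod, \val v = u.
Proof.
move=> Lu; have hu : u \in span_pred sub_grading.
  have [s _ ->] := pr_sum u; apply: rpred_sum => n _; apply: (@deg_span _ _ _ n).
  by split; [rewrite pr_pr eqxx | exact: (gsub_pr hL)].
by exists (GSpan hu).
Qed.

Definition submod_incl : qhom submod M.
Proof.
apply: (@mkqhom k submod M (fun u v => v = \val u)).
- by [].
- by move=> u v u' v' -> ->.
- by move=> b u v ->.
- by move=> n u v ->; rewrite submod_pr.
- by move=> u; exists 0%N => w _; exists (\val (bw k w *: u)).
- by move=> v ->; exact: tors0.
Defined.

End Submodule.

Section MonicEpic.
Variables (k : fieldType) (M N : grmod k) (f : qhom M N).

Lemma qhom_monic : (forall u v, f u v -> tors v -> tors u) -> @Defs.monic (QGr k) M N f.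
Proof.
move=> hf W a b /qeqP ab; apply/qeqP => w u u' hu hu'; apply: tors_long.
have [m hm] := dom_long f u; have [n hn] := dom_long f u'; exists (maxn m n) => v.
rewrite geq_max => /andP[/hm[y hy] /hn[y' hy']]; rewrite scalerBr.
apply: hf (graphB hy hy') _; apply: (ab (bw k v *: w)).
  by exists (bw k v *: u) => //; exact: graphZ.
by exists (bw k v *: u') => //; exact: graphZ.
Qed.

Lemma qhom_epic : (forall v, exists u, f u v) -> @Defs.epic (QGr k) M N f.
Proof.
move=> hf W a b /qeqP ab; apply/qeqP => v w w' hw hw'.
by have [u fu] := hf v; apply: (ab u); exists v.
Qed.

End MonicEpic.

Lemma submod_monic (k : fieldType) (M : grmod k) (L : M -> Prop) (hL : graded_submodule L) :
  @Defs.monic (QGr k) (submod hL) M (submod_incl hL).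
Proof.
apply: qhom_monic => u v /= -> [n hn]; exists n => w /hn hw.
by apply: val_inj; rewrite linearZ.
Qed.

(** * Zero objects *)

Section ZeroObjects.
Variable k : fieldType.
Implicit Types M N : grmod k.

Lemma qeq_tors M N (f g : qhom M N) :
  (forall u : M, tors u) \/ (forall v : N, tors v) -> qeq f g.
Proof.
move=> h; apply/qeqP => u v v' hv hv'; case: h => h; last exact: h.
by apply: torsB; [exact: qhom_tors hv _ | exact: qhom_tors hv' _].
Qed.

Definition zero_qhom M N : qhom M N.
Proof.
apply: (@mkqhom k M N (fun _ v => v = 0)).
- by [].
- by move=> u v u' v' -> ->; rewrite addr0.
- by move=> b u v ->; rewrite scaler0.
- by move=> n u v ->; exact: pr0.
- by move=> u; exists 0%N => w _; exists 0.
- by move=> v ->; exact: tors0.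
Defined.

Lemma qeq_id_zero M : qeq (qid M) (zero_qhom M M) -> forall u : M, tors u.
Proof. by move=> /qeqP h u; rewrite -[u]subr0; apply: (h u). Qed.

Lemma zero_objectP M : @is_zero_object (QGr k) M <-> forall u : M, tors u.
Proof.
split=> [[h _]|h]; last first.
  by split=> N; [exists (zero_qhom N M) | exists (zero_qhom M N)] => g;
    apply: qeq_tors; [right | left].
have [f hf] := h M; apply: qeq_id_zero.
exact: qeq_trans (hf (qid M)) (qeq_sym (hf (zero_qhom M M))).
Qed.

(** In each case the hypothesis makes the identity and the zero endomorphism
coincide, because they agree after composition with morphisms from or to torsion
modules. *)
Lemma zero_closed : closed_subcategory (fun M : Ob (QGr k) => is_zero_object M).
Proof.
split.
- move=> M N i hi /zero_objectP hN; apply/zero_objectP; apply: qeq_id_zero.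
  by apply: hi; apply: qeq_tors; right.
- move=> M N p hp /zero_objectP hM; apply/zero_objectP; apply: qeq_id_zero.
  by apply: hp; apply: qeq_tors; left.
- move=> I F S s hs hF; apply/zero_objectP; apply: qeq_id_zero.
  have [h [_ hu]] := hs S s.
  apply: qeq_trans (hu (qid S) _) (qeq_sym (hu (zero_qhom S S) _)) => i;
    by apply: qeq_tors; left; apply/zero_objectP.
- move=> I F P p hp hF; apply/zero_objectP; apply: qeq_id_zero.
  have [h [_ hu]] := hp P p.
  apply: qeq_trans (hu (qid P) _) (qeq_sym (hu (zero_qhom P P) _)) => i;
    by apply: qeq_tors; right; apply/zero_objectP.
Qed.

(** A zero object is a coproduct of the empty family. *)
Lemma closed_zero (A : Ob (QGr k) -> Prop) M : closed_subcategory A ->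
  is_zero_object (C := QGr k) M -> A M.
Proof.
move=> cA /zero_objectP hM.
apply: (closed_coprod cA (I := void) (F := of_void _) (s := fun i => of_void _ i)); last by case.
move=> W q; exists (zero_qhom M W); split; first by case.
by move=> h _; apply: qeq_tors; left.
Qed.

End ZeroObjects.

(** * Every module is a subquotient of a power *)

(** The element [b'] is the part of degree [n - d] of [b]; that it does not depend
on [M] allows the same relation to be used in two modules. *)
Lemma pr_scale (k : fieldType) (n d : int) (b : B k) : exists b' : B k,
  forall (M : grmod k) (u : M), pr d u = u -> pr n (b *: u) = b' *: u.
Proof.
have [s [a ->]] := bw_span b.
exists (\sum_(w <- s | n == Posz (size w) + d) a w *: bw k w) => M u hu.
rewrite !scaler_suml pr_sumE [RHS]big_mkcond; apply: eq_bigr => w _.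
rewrite scale_bw pr_scalar -hu bw_pr; case: ifP => _; last by rewrite scaler0.
by rewrite scale_bw.
Qed.

Section FamilySpan.
Variables (k : fieldType) (J : eqType) (d : J -> int).

Definition comb (M : grmod k) (e : J -> M) (s : seq (B k * J)) : M :=
  \sum_(t <- s) t.1 *: e t.2.

Lemma comb_cat (M : grmod k) (e : J -> M) s s' : comb e (s ++ s') = comb e s + comb e s'.
Proof. exact: big_cat. Qed.

Lemma combZ (M : grmod k) (e : J -> M) b s : comb e [seq (b * t.1, t.2) | t <- s] = b *: comb e s.
Proof.
rewrite /comb big_map scaler_sumr; apply: eq_bigr => t _; exact: esym (scalerA _ _ _).
Qed.

Lemma comb_pr n s : exists s', forall (M : grmod k) (e : J -> M),
  (forall j, pr (d j) (e j) = e j) -> pr n (comb e s) = comb e s'.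
Proof.
have /choice[f hf] : forall t : B k * J, exists b' : B k,
    forall (M : grmod k) (u : M), pr (d t.2) u = u -> pr n (t.1 *: u) = b' *: u.
  by move=> t; exact: pr_scale.
exists [seq (f t, t.2) | t <- s] => M e he.
by rewrite /comb big_map pr_sumE; apply: eq_bigr => t _; exact: hf.
Qed.

(** Group the terms according to their index. *)
Lemma comb_eq0 (M : grmod k) (e : J -> M) s :
  (forall j, \sum_(t <- s | t.2 == j) t.1 = 0) -> comb e s = 0.
Proof.
move=> hs; rewrite /comb.
have -> : \sum_(t <- s) t.1 *: e t.2 =
    \sum_(t <- s) \sum_(j <- undup (map snd s) | t.2 == j) t.1 *: e j.
  rewrite big_seq [RHS]big_seq; apply: eq_bigr => t ts.
  rewrite (eq_bigl (fun j => j == t.2)) => [|j]; last by rewrite eq_sym.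
  rewrite -big_filter (_ : filter _ _ = [:: t.2]) ?big_seq1 //.
  apply: filter_pred1_uniq; first exact: undup_uniq.
  by rewrite mem_undup map_f.
rewrite (exchange_big_dep xpredT) //= big1 // => j _.
by rewrite -scaler_suml hs scale0r.
Qed.

Section Span.
Variables (P : grmod k) (e : J -> P).
Hypothesis he : forall j, pr (d j) (e j) = e j.

Definition comb_span (u : P) := exists s, u = comb e s.

Lemma comb_span_gsub : graded_submodule comb_span.
Proof.
split=> [|u v [s ->] [t ->]|b u [s ->]|n u [s ->]].
- by exists [::]; rewrite /comb big_nil.
- by exists (s ++ t); rewrite comb_cat.
- by eexists; rewrite -combZ.
- by have [t ht] := comb_pr n s; exists t; exact: ht.
Qed.

Variables (Y : grmod k) (g : J -> Y).
Hypotheses (hg : forall j, pr (d j) (g j) = g j)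
  (e_free : forall s, comb e s = 0 -> forall j, \sum_(t <- s | t.2 == j) t.1 = 0).

Notation U := (submod comb_span_gsub).

Definition comb_graph (u : U) (y : Y) :=
  exists2 s, \val u = comb e s & y = comb g s.

(** Well defined because, by freeness, a combination of the [e j] that vanishes
has coefficients that cancel for each [j]. *)
Definition comb_hom : qhom U Y.
Proof.
apply: (@mkqhom k U Y comb_graph).
- by exists [::]; rewrite /comb big_nil.
- by move=> u v u' v' [s hs ->] [t ht ->]; exists (s ++ t); rewrite comb_cat // -hs -ht.
- move=> b u v [s hs ->]; exists [seq (b * t.1, t.2) | t <- s]; rewrite combZ //.
  by rewrite -hs linearZ.
- move=> n u v [s hs ->]; have [t ht] := comb_pr n s; exists t; last exact: ht.
  by rewrite submod_pr hs; exact: ht.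
- move=> u; exists 0%N => w _; have [s hs] := submodP (bw k w *: u).
  by exists (comb g s), s.
- move=> y [s hs ->]; rewrite comb_eq0; first exact: tors0.
  by apply: e_free; rewrite -hs.
Defined.

Lemma comb_hom_epic : (forall y, exists s, y = comb g s) ->
  @Defs.epic (QGr k) U Y comb_hom.
Proof.
move=> h; apply: qhom_epic => y; have [s ->] := h y.
have [|u hu] := @submod_ex _ _ _ comb_span_gsub (comb e s); first by exists s.
by exists u, s.
Qed.

End Span.
End FamilySpan.

Lemma closed_all (k : fieldType) (A : Ob (QGr k) -> Prop) (X : grmod k) :
  closed_subcategory A -> A X -> (exists x : X, ~ tors x) -> forall Y, A Y.
Proof.
move=> cA AX X0 Y.
(* The pair [(y, n)] indexes the homogeneous generator [pr n y] of [Y]. *)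
pose J : eqType := (Y * int)%type.
pose d (j : J) : int := j.2.
pose g (j : J) : Y := pr j.2 j.1.
pose e := diag_elt X d.
have he j : pr (d j) (e j) = e j := diag_elt_pr X d j.
have hg j : pr (d j) (g j) = g j by rewrite /g pr_pr eqxx.
have AP : A (power X (J * (B k -> X))).
  exact: (closed_prod cA (@power_product k X (J * (B k -> X))) (fun=> AX)).
have AU := closed_sub cA (@submod_monic k _ _ (comb_span_gsub he)) AP.
apply: (closed_quo cA (@comb_hom_epic _ _ _ _ _ he _ _ hg (diag_free X0) _)) AU => y.
have [s _ ->] := pr_sum y; exists [seq (1, (y, n)) | n <- s].
by rewrite /comb big_map; apply: eq_bigr => n _; rewrite scale1r.
Qed.

Theorem proposition1p5 (k : fieldType) (A : Ob (QGr k) -> Prop) :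
  closed_subcategory A <->
  (forall X, A X) \/ (forall X, A X <-> is_zero_object X).
Proof.
split=> [cA|[hA|hA]].
- have [h|h] := pselect (forall X, A X -> is_zero_object X).
    by right=> X; split; [exact: h | exact: closed_zero].
  left; have [X AX X0] : exists2 X, A X & ~ is_zero_object X.
    by apply: contrapT => hX; apply: h => X AX; apply: contrapT => X0; apply: hX; exists X.
  apply: (closed_all cA AX); apply: contrapT => hX; apply: X0; apply/zero_objectP => u.
  by apply: contrapT => hu; apply: hX; exists u.
- by split=> *; exact: hA.
- have -> : A = (fun M => is_zero_object M) by apply/funext => M; apply/propext.
  exact: zero_closed.
Qed.
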